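(* Let $W=W(\Gamma,\mathbf m)$ be a graph product of primary cyclic groups. Then $\operatorname{Aut}W$ is word hyperbolic if and only if the following conditions are satisfied: (1) $\Gamma$ has no SIL (separating intersection of links); (2) every circuit in $\Gamma$ of length four contains a chord.
   Context: $\Gamma$ is a finite simplicial graph with non-empty vertex set $V=\{v_1,\dots,v_N\}$; $d$ is the path metric on $\Gamma$ (vertices in different components are at distance $\infty$). Each index $i$ is given a label $\mathbf m(i)$ which is a prime power $p^\alpha$, $\alpha\ge1$. The graph product of primary cyclic groups $W=W(\Gamma,\mathbf m)$ is the group with generators $V$ and relations $v_i^{\mathbf m(i)}=1$ and $v_jv_k=v_kv_j$ whenever $v_j,v_k$ are adjacent in $\Gamma$. $L_i$ is the link of $v_i$: the full subgraph on the vertices adjacent to $v_i$. $\Gamma$ has a SIL if there exist $1\le i<j\le N$ such that $d(v_i,v_j)\ge2$ and there is a connected component $R$ of $\Gamma\setminus(L_i\cap L_j)$ with $v_i,v_j\notin R$. *)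

(* Defs.v *)
From HB Require Import structures.
From mathcomp Require Import all_boot all_order all_algebra.
From mathcomp Require Import boolp.

Set Implicit Arguments.
Unset Strict Implicit.
Unset Printing Implicit Defensive.

Import Order.TTheory GRing.Theory Num.Theory.

Local Open Scope quotient_scope.
Local Open Scope group_scope.

(* A group word: the letter (x, false) stands for x and (x, true) for x^-1. *)
Definition word (X : Type) := seq (X * bool).

Definition word_inv (X : Type) (w : word X) : word X :=
  rev [seq (a.1, ~~ a.2) | a <- w].

Section Presentation.
Variables (X : choiceType) (rels : word X -> word X -> Prop).

(* The smallest congruence on words that contains the free cancellations and
   the relations u = v for which [rels u v] holds. *)
Inductive pres_eq : word X -> word X -> Prop :=
  | pres_eq_refl u : pres_eq u u
  | pres_eq_sym u v : pres_eq u v -> pres_eq v u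
  | pres_eq_trans u v w : pres_eq u v -> pres_eq v w -> pres_eq u w
  | pres_eq_cat u u' v v' :
      pres_eq u u' -> pres_eq v v' -> pres_eq (u ++ v) (u' ++ v')
  | pres_eq_cancel x b : pres_eq [:: (x, b); (x, ~~ b)] [::]
  | pres_eq_rel u v : rels u v -> pres_eq u v.

Definition pres_eqb : rel (word X) := fun u v => `[< pres_eq u v >].

Lemma pres_eqb_refl : reflexive pres_eqb.
Proof. by move=> u; apply/asboolP; apply: pres_eq_refl. Qed.

Lemma pres_eqb_sym : symmetric pres_eqb.
Proof.
by move=> u v; apply/asboolP/asboolP; apply: pres_eq_sym.
Qed.

Lemma pres_eqb_trans : transitive pres_eqb.
Proof.
move=> v u w /asboolP uv /asboolP vw.
by apply/asboolP; apply: pres_eq_trans uv vw.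
Qed.

Canonical pres_equiv_rel :=
  EquivRel pres_eqb pres_eqb_refl pres_eqb_sym pres_eqb_trans.

Definition presented_group := {eq_quot pres_eqb}.

HB.instance Definition _ : EqQuotient _ pres_eqb presented_group :=
  EqQuotient.on presented_group.
HB.instance Definition _ := Choice.on presented_group.

Definition pres_pi (w : word X) : presented_group := \pi_presented_group w.

Lemma pres_piE u v : pres_pi u = pres_pi v <-> pres_eq u v.
Proof.
split=> [/eqmodP/asboolP //|uv]; apply/eqmodP; exact/asboolP.
Qed.

Lemma pres_repr w : pres_eq (repr (pres_pi w)) w.
Proof. by apply/pres_piE; rewrite /pres_pi reprK. Qed.

Lemma word_invK : involutive (@word_inv X).
Proof.
move=> w; rewrite /word_inv map_rev revK -map_comp -[RHS]map_id.
by apply: eq_map => -[x b] /=; rewrite negbK.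
Qed.

Lemma pres_eq_invr w : pres_eq (w ++ word_inv w) [::].
Proof.
elim: w => [|[x b] w IH]; first exact: pres_eq_refl.
apply: pres_eq_trans (pres_eq_cancel x b).
rewrite /word_inv /= rev_cons -cats1 -/(word_inv w) catA.
apply: (@pres_eq_cat [:: (x, b)] [:: (x, b)] _ [:: (x, ~~ b)]).
  exact: pres_eq_refl.
apply: (@pres_eq_cat _ [::] _ [:: (x, ~~ b)]) => //; exact: pres_eq_refl.
Qed.

Lemma pres_eq_invl w : pres_eq (word_inv w ++ w) [::].
Proof. by rewrite -{2}(word_invK w); apply: pres_eq_invr. Qed.

Lemma pres_word_inv u v : pres_eq u v -> pres_eq (word_inv u) (word_inv v).
Proof.
move=> uv; apply: (@pres_eq_trans _ (word_inv u ++ (v ++ word_inv v))).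
  rewrite -{1}[word_inv u]cats0.
  apply: pres_eq_cat; first exact: pres_eq_refl.
  exact/pres_eq_sym/pres_eq_invr.
rewrite catA -[X in pres_eq _ X]cat0s.
apply: pres_eq_cat; last exact: pres_eq_refl.
apply: pres_eq_trans (pres_eq_invl u).
by apply: pres_eq_cat; [apply: pres_eq_refl|apply: pres_eq_sym].
Qed.

Definition pres_one : presented_group := pres_pi [::].
Definition pres_mul (x y : presented_group) : presented_group :=
  pres_pi (repr x ++ repr y).
Definition pres_inv (x : presented_group) : presented_group :=
  pres_pi (word_inv (repr x)).

Lemma pres_mulE u v : pres_mul (pres_pi u) (pres_pi v) = pres_pi (u ++ v).
Proof. by apply/pres_piE; apply: pres_eq_cat; apply: pres_repr. Qed.

Lemma pres_invE u : pres_inv (pres_pi u) = pres_pi (word_inv u).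
Proof. by apply/pres_piE; apply: pres_word_inv; apply: pres_repr. Qed.

Lemma pres_piP (x : presented_group) : exists u, x = pres_pi u.
Proof. by exists (repr x); rewrite /pres_pi reprK. Qed.

Lemma pres_mulA : associative pres_mul.
Proof.
move=> x y z; have [u ->] := pres_piP x; have [v ->] := pres_piP y.
by have [w ->] := pres_piP z; rewrite !pres_mulE catA.
Qed.

Lemma pres_mul1 : left_id pres_one pres_mul.
Proof. by move=> x; have [u ->] := pres_piP x; rewrite pres_mulE. Qed.

Lemma pres_mulr1 : right_id pres_one pres_mul.
Proof. by move=> x; have [u ->] := pres_piP x; rewrite pres_mulE cats0. Qed.

Lemma pres_mulV : right_inverse pres_one pres_inv pres_mul.
Proof.
move=> x; have [u ->] := pres_piP x; rewrite pres_invE pres_mulE.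
by apply/pres_piE; apply: pres_eq_invr.
Qed.

Lemma pres_mulVl : left_inverse pres_one pres_inv pres_mul.
Proof.
move=> x; have [u ->] := pres_piP x; rewrite pres_invE pres_mulE.
by apply/pres_piE; apply: pres_eq_invl.
Qed.

HB.instance Definition _ := isGroup.Build presented_group
  pres_mulA pres_mul1 pres_mulr1 pres_mulVl pres_mulV.

End Presentation.

Section Aut.
Variable G : groupType.

(* The inverse is a field, but it is determined by aut_fun (aut_eqP). *)
Record aut := Aut {
  aut_fun :> G -> G;
  aut_inv_fun : G -> G;
  aut_funM : {morph aut_fun : x y / x * y};
  aut_funK : cancel aut_fun aut_inv_fun;
  aut_inv_funK : cancel aut_inv_fun aut_fun
}.

Lemma aut_eqP (f g : aut) : aut_fun f =1 aut_fun g -> f = g.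
Proof.
case: f g => [f f' fM fK f'K] [g g' gM gK g'K] /= /funext fg; subst g.
have ff' : f' = g' by apply: funext => x; rewrite -{1}(g'K x) fK.
by subst g'; congr Aut; apply: Prop_irrelevance.
Qed.

HB.instance Definition _ := gen_eqMixin aut.
HB.instance Definition _ := gen_choiceMixin aut.

Definition aut_one : aut :=
  @Aut id id (fun _ _ => erefl) (fun _ => erefl) (fun _ => erefl).

Definition aut_mul (f g : aut) : aut.
Proof.
refine (@Aut (f \o g) (aut_inv_fun g \o aut_inv_fun f) _ _ _).
- by move=> x y; rewrite /= !aut_funM.
- exact: can_comp (@aut_funK f) (@aut_funK g).
- exact: can_comp (@aut_inv_funK g) (@aut_inv_funK f).
Defined.

Definition aut_inv (f : aut) : aut.
Proof.
refine (@Aut (aut_inv_fun f) f _ (@aut_inv_funK f) (@aut_funK f)).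
move=> x y; apply: (can_inj (@aut_funK f)).
by rewrite aut_funM !aut_inv_funK.
Defined.

Lemma aut_mulA : associative aut_mul.
Proof. by move=> f g h; apply: aut_eqP. Qed.

Lemma aut_mul1 : left_id aut_one aut_mul.
Proof. by move=> f; apply: aut_eqP. Qed.

Lemma aut_mulr1 : right_id aut_one aut_mul.
Proof. by move=> f; apply: aut_eqP. Qed.

Lemma aut_mulVl : left_inverse aut_one aut_inv aut_mul.
Proof. by move=> f; apply: aut_eqP => x; apply: aut_funK. Qed.

Lemma aut_mulV : right_inverse aut_one aut_inv aut_mul.
Proof. by move=> f; apply: aut_eqP => x; apply: aut_inv_funK. Qed.

HB.instance Definition _ := isGroup.Build aut
  aut_mulA aut_mul1 aut_mulr1 aut_mulVl aut_mulV.

End Aut.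

Section Hyperbolic.
Variable G : groupType.
Implicit Types (S : seq G) (g x y z w : G).

Definition eval_word (w : word G) : G :=
  \prod_(a <- w) (if a.2 then a.1^-1 else a.1).

Definition spelled S g (n : nat) : Prop :=
  exists w : word G,
    [/\ size w = n, {in w, forall a, a.1 \in S} & eval_word w = g].

Definition generates S : Prop := forall g, exists n, spelled S g n.

Lemma spelled_ex S (genS : generates S) g : exists n, `[< spelled S g n >].
Proof. by have [n gn] := genS g; exists n; apply/asboolP. Qed.

Definition word_length S (genS : generates S) g : nat :=
  ex_minn (spelled_ex genS g).

Definition word_dist S (genS : generates S) x y : nat :=
  word_length genS (x^-1 * y).

Definition gromov_product S (genS : generates S) x y w : rat :=
  (((word_dist genS x w)%:R + (word_dist genS y w)%:R
    - (word_dist genS x y)%:R) / 2%:R)%R.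

(* Gromov's definition: for some finite generating set, the group with its
   word metric is a delta-hyperbolic metric space for some delta >= 0. *)
Definition word_hyperbolic : Prop :=
  exists (S : seq G) (genS : generates S) (delta : rat),
    (0 <= delta)%R /\
    forall x y z w,
      (Num.min (gromov_product genS x z w) (gromov_product genS z y w) - delta
       <= gromov_product genS x y w)%R.

End Hyperbolic.

(* A finite simplicial graph is a symmetric irreflexive relation on 'I_N. *)
Section Graph.
Variables (N : nat) (adj : rel 'I_N).
Implicit Types (i j k : 'I_N) (A R : {set 'I_N}).

(* d(i, j) >= n for the path metric; it holds for all n when i and j are in
   different components, i.e. d(i, j) is infinite *)
Definition dist_geq i j (n : nat) : Prop :=
  forall p : seq 'I_N, path adj i p -> last i p = j -> (n <= size p)%N.

Definition link i : {set 'I_N} := [set k | adj i k].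

Definition full_subgraph A : rel 'I_N :=
  [rel x y | [&& x \in A, y \in A & adj x y]].

Definition is_component A R : Prop :=
  exists2 x, x \in A & R = [set y | connect (full_subgraph A) x y].

Definition has_SIL : Prop :=
  exists i j, [/\ (i < j)%N, dist_geq i j 2 &
    exists R, [/\ is_component (~: (link i :&: link j)) R,
                  i \notin R & j \notin R]].

(* A chord of a circuit c joins two vertices of c that are not consecutive
   on c. *)
Definition has_chord (c : seq 'I_N) : Prop :=
  exists x y, [/\ x \in c, y \in c, adj x y, next c x != y & next c y != x].

Definition four_circuits_have_chords : Prop :=
  forall c : seq 'I_N, size c = 4 -> ucycle adj c -> has_chord c.

End Graph.

Definition prime_power (q : nat) : Prop :=
  exists p a : nat, [/\ prime p, (0 < a)%N & q = (p ^ a)%N].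

Section GraphProduct.
Variables (N : nat) (adj : rel 'I_N) (m : 'I_N -> nat).

Inductive graph_product_rels : word 'I_N -> word 'I_N -> Prop :=
  | gp_order i : graph_product_rels (nseq (m i) (i, false)) [::]
  | gp_commute j k : adj j k ->
      graph_product_rels [:: (j, false); (k, false)]
                         [:: (k, false); (j, false)].

Definition graph_product := presented_group graph_product_rels.

End GraphProduct.

(* Main.v *)
(* Write W for the graph product and, for a vertex v, call the cosets
   g W_(star v) the walls of type v; each wall cuts W into m(v) sectors.

   If there is a SIL (i, j, R), then conjugation by v_i v_j and the partial
   conjugation of R by v_i v_j generate a subgroup Z^2 of Aut W; a chordless
   square v_0 v_1 v_2 v_3 gives Z^2 as conjugations by v_0 v_2 and v_1 v_3.
   A hyperbolic group has no such subgroup, because in it an abelian subgroup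
   meets the ball of radius R in O(R) elements.

   Conversely, without chordless squares, two disjoint sets of vertices which
   are completely joined to each other cannot both generate infinite subgroups,
   so that the quasi-intervals of W form thin triangles. Without a SIL, Inn W has
   finite index in Aut W: composing f with an inner automorphism, assume that the
   total length of the f(v_i) is minimal. If some f(v_i) is long, then, among the
   walls of one type that separate 1 from the residues stabilized by f(v_i), two
   walls separate the f(v_j) in the same way. The vertices c for which f(c)
   stabilizes these two walls separate the graph and, as there is no SIL, the
   rest has only two components. A ping-pong argument with the images of cliques
   of these components contradicts the fact that the rotation around the
   wall lies in the image of f. Finally, the criterion of guessing geodesics
   applies to Aut W, with the quasi-intervals of W as guessed paths. *)

From HB Require Import structures.
From mathcomp Require Import all_boot all_order all_algebra.
From mathcomp Require Import boolp.
From mathcomp Require Import zify lra.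
Require Import Defs.

Set Implicit Arguments.
Unset Strict Implicit.
Unset Printing Implicit Defensive.

(** * Guessing geodesics *)

(** All the geometry of W is carried by one function: [hd v x], the exponent of the [v]-syllable
    that can be shuffled to the front of [x], names the sector of the wall (1, v) that contains the
    chamber [x], and a general wall (w, v) is treated after translation by [w^-1]. An element [t]
    stabilizes (1, v) when [supp t] lies in [star v]; a torsion element that does not do so has its
    residues in the single sector [hd v t]. The images of the generators under an automorphism are
    torsion, so their position with respect to a wall is a finite datum, constant along those edges
    of the graph whose ends do not stabilize the wall. Quasi-intervals replace geodesics because
    their definition is local at the point [x]: thinness becomes a statement about the heads of two
    prefixes. The map from W to Aut W is neither injective nor onto; its kernel is the finite
    centre, its image has finite index when there is no SIL. The guessed paths of Aut W are
    therefore those of W between the inner parts of two automorphisms, up to bounded errors. *)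

Section GuessingGeodesics.
Variables (T : Type) (d : T -> T -> nat) (L : T -> T -> T -> Prop) (h : nat).
Hypothesis d_sym : forall x y, d x y = d y x.
Hypothesis d_tri : forall x y z, d x z <= d x y + d y z.
Hypothesis d_geod : forall x y, exists c : nat -> T,
  [/\ c 0 = x, c (d x y) = y &
      forall i j, i <= j <= d x y -> d (c i) (c j) = j - i].
Hypothesis L_l : forall x y, L x y x.
Hypothesis L_r : forall x y, L x y y.
Hypothesis L_conn : forall x y (P : T -> Prop), P x ->
  (forall p q, L x y p -> L x y q -> d p q <= h -> P p -> P q) -> P y.
Hypothesis L_thin : forall x y z p, L x y p ->
  exists2 q, L x z q \/ L z y q & d p q <= h.
Hypothesis L_small : forall x y p, d x y <= 1 -> L x y p -> d x p <= h.

(** The path is halved [k] times; each halving applies [L_thin] once and costs [h], and [L_small]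
    settles a single step. Hence the bound is logarithmic in the length. *)
Lemma guess_near_path k (c : nat -> T) a n p : n <= 2 ^ k ->
  (forall i, a <= i < a + n -> d (c i) (c i.+1) <= 1) ->
  L (c a) (c (a + n)) p ->
  exists2 i, a <= i <= a + n & d p (c i) <= k.+1 * h.
Proof.
elim: k a n p => [|k IH] a n p.
  rewrite expn0 => n1 path_c Lp; exists a; first by lia.
  rewrite d_sym mul1n; apply: L_small Lp.
  case: n n1 path_c => [|[|//]] _ path_c; last by rewrite addn1; apply: path_c; lia.
  rewrite addn0; have [f [f0 f1 ff]] := d_geod (c a) (c a).
  by have := ff 0 0 isT; rewrite f0 => ->.
move=> nk path_c Lp; pose n1 := minn n (2 ^ k).
rewrite expnS in nk.
have [q Lq pq] := L_thin (c (a + n1)) Lp.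
have [i ai qi] : exists2 i, a <= i <= a + n & d q (c i) <= k.+1 * h.
  case: Lq => Lq.
    have [||i ai qi] := IH a n1 q _ _ Lq; first by lia.
      by move=> i ai; apply: path_c; lia.
    by exists i => //; lia.
  have E : a + n = (a + n1) + (n - n1) by lia.
  rewrite E in Lq.
  have [||i ai qi] := IH (a + n1) (n - n1) q _ _ Lq; first by lia.
    by move=> i ai; apply: path_c; lia.
  by exists i => //; lia.
exists i => //; rewrite mulSn.
by apply: leq_trans (d_tri _ q _) _; lia.
Qed.

Lemma linear_lt_exp a b : exists k0, forall k, k0 <= k -> a * k + b <= 2 ^ k.
Proof.
(* [2 ^ k] is at least the square of [2 ^ (k %/ 2)]; one factor exceeds [2 * a + b], the other
   [k %/ 2]. *)
exists (4 * (a + b) + 4) => k hk.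
have E : 2 ^ (k %/ 2) * 2 ^ (k %/ 2) <= 2 ^ k.
  by rewrite -expnD leq_exp2l //; lia.
have := ltn_expl (k %/ 2) (isT : 1 < 2).
set u := 2 ^ _ in E * => ku; apply: leq_trans E.
have u_ge : 2 * a + b + 1 <= u by lia.
have au : a * k <= a * (2 * u) by rewrite leq_mul2l; lia.
have : (2 * a + b + 1) * u <= u * u by rewrite leq_mul2r u_ge orbT.
have : b * 1 <= b * u by rewrite leq_mul2l; lia.
lia.
Qed.

(* Bowditch's argument: the optimal D for which the guessed paths between points
   of a fixed geodesic stay D-close to it satisfies D <= h * (log D + O(1)),
   since a guessed path of length O(D) already contains a point at distance D. *)
Lemma guess_near_geodesic : exists D0, forall x y p, L x y p ->
  d x p + d p y <= d x y + 2 * D0.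
Proof.
(* Below, [D <= (k + 3) * h] meets [2 ^ k.-1 < v - u <= 2 * r] with [r] linear in [D]; this affine
   function of [k.-1] dominates the resulting bound on [2 * r]. *)
have [k0 hk0] := linear_lt_exp (8 * h) (28 * h + 4).
exists ((k0 + 4) * h) => x y p Lp.
have [c [c0 cn cc]] := d_geod x y; set n := d x y in c0 cn cc *.
pose Q D := forall a b q, a <= b <= n -> L (c a) (c b) q ->
  exists2 i, a <= i <= b & d q (c i) <= D.
have log_bound k a b q : b - a <= 2 ^ k -> a <= b <= n -> L (c a) (c b) q ->
    exists2 i, a <= i <= b & d q (c i) <= k.+1 * h.
  move=> ba ab Lq; have E : b = a + (b - a) by lia.
  rewrite E in Lq.
  have [|i ai qi] := guess_near_path ba _ Lq; first by move=> i ai; rewrite cc; lia.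
  by exists i => //; lia.
have exQ : exists D, `[< Q D >].
  exists (n.+1 * h); apply/asboolP => a b q ab Lq.
  apply: log_bound Lq => //; apply: leq_trans (leq_subr _ _) _.
  by apply: ltnW; apply: leq_ltn_trans (ltn_expl n (isT : 1 < 2)); lia.
have [D /asboolP QD minD] := ex_minnP exQ.
have D_le : D <= (k0 + 4) * h.
  rewrite leqNgt; apply/negP => D_gt.
  have D_pos : 0 < D by apply: leq_ltn_trans D_gt.
  have : ~ Q D.-1 by move=> /asboolP /minD; lia.
  apply; move=> a b q ab Lq; apply: contrapT => nq.
  have [t tab qt] := QD a b q ab Lq.
  have far i : a <= i <= b -> D <= d q (c i).
    move=> iab; rewrite leqNgt; apply/negP => lt; apply: nq; exists i => //; lia.
  (* A point within [2 * h] of [q] is within [2 * D + 2 * h] of [c t] as soon as it is [D]-close to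
     some [c i]; [r] is just out of this reach. *)
  pose r := 2 * D + 2 * h + 1.
  pose u := maxn a (t - r); pose v := minn b (t + r).
  have near_q q' i : d q q' <= 2 * h -> a <= i <= b -> d q' (c i) + 2 * h >= D.
    by move=> qq' iab; have := far i iab; have := d_tri q q' (c i); lia.
  have away q' i : d q q' <= 2 * h -> a <= i <= b -> i + r <= t \/ t + r <= i ->
      d q' (c i) <= D -> False.
    move=> qq' iab tri qi.
    have := d_tri (c i) q' (c t); have := d_tri q' q (c t).
    rewrite (d_sym q' q) (d_sym (c i) q').
    case: tri => tri; first by rewrite cc; rewrite /r in tri; lia.
    by rewrite (d_sym (c i) (c t)) cc; rewrite /r in tri; lia.
  have kill_end j q' : d q q' <= 2 * h -> a <= j <= b -> L (c j) (c j) q' -> False.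
    move=> qq' jab Lq'; have := L_small _ Lq'; rewrite cc; last by lia.
    move=> /(_ ltac:(lia)); rewrite (d_sym (c j)).
    have := near_q q' j qq' jab.
    have : 3 * h <= (k0 + 4) * h by nia.
    lia.
  (* Cutting at [u] and [v] brings [q] within [2 * h] of one of three guessed paths. The outer two
     are excluded by [away] or [kill_end]; the middle one spans a length of at most [2 * r], where
     the logarithmic bound applies. *)
  have [q1 Lq1 qq1] := L_thin (c u) Lq.
  case: Lq1 => Lq1.
    have qq1' : d q q1 <= 2 * h by lia.
    have [ua|ua] : u = a \/ t - r = u /\ a < u by lia.
      by apply: (kill_end a q1) => //; [lia | rewrite ua in Lq1].
    have [|i ai q1i] := QD a u q1 _ Lq1; first by lia.
    apply: (away q1 i) => //; first by lia.
    by left; lia.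
  have [q2 Lq2 q12] := L_thin (c v) Lq1.
  have qq2 : d q q2 <= 2 * h by have := d_tri q q1 q2; lia.
  case: Lq2 => Lq2; last first.
    have [vb|vb] : v = b \/ t + r = v /\ v < b by lia.
      by apply: (kill_end b q2) => //; [lia | rewrite vb in Lq2].
    have [|i ai q2i] := QD v b q2 _ Lq2; first by lia.
    apply: (away q2 i) => //; first by lia.
    by right; lia.
  pose k := maxn k0 (up_log 2 (v - u)).
  have vuk : v - u <= 2 ^ k.
    apply: leq_trans (up_logP (v - u) (isT : 1 < 2)) _.
    by rewrite leq_exp2l // leq_maxr.
  have [|i ui q2i] := log_bound k u v q2 vuk _ Lq2; first by lia.
  have := near_q q2 i qq2; move=> /(_ ltac:(lia)) Di.
  have Dk : D <= (k + 3) * h by rewrite mulSn in q2i; rewrite mulnDl; lia.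
  have [kk|kk] : k = k0 \/ k0 < k /\ k = up_log 2 (v - u) by lia.
    have : (k0 + 3) * h <= (k0 + 4) * h by rewrite leq_mul2r; lia.
    by rewrite kk in Dk; lia.
  have vu2 : 1 < v - u.
    by rewrite ltnNge; apply/negP => le1; have := up_log_eq0 2 (v - u); rewrite le1; lia.
  have [lt_k _] := andP (up_log_bounds (isT : 1 < 2) vu2).
  have le_vu : v - u <= 2 * r by rewrite /u /v; lia.
  have := hk0 k.-1; rewrite -kk.2 in lt_k; rewrite /r in le_vu.
  move=> /(_ ltac:(lia)); nia.
have [||i ai pi] := QD 0 n p; first by lia.
  by rewrite c0 cn.
have := d_tri x (c i) p; have := d_tri p (c i) y.
rewrite -{2}c0 -{2}cn (d_sym (c i) p).
have := cc 0 i; rewrite c0 => ->; last by lia.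
by have := cc i n; rewrite cn => ->; lia.
Qed.

(** By connectedness some [p] between [x] and [y] is close to both sides that end at [w], so the
    Gromov product of [x] and [y] at [w] is at least [d p w] up to a constant. A point [s] near [p]
    on a side that ends at [z] bounds one of the other two products by [d s w]. *)
Lemma guess_four_point : exists D, forall x y z w,
  minn (d x w + d z w - d x z) (d z w + d y w - d z y) + d x y
    <= d x w + d y w + D.
Proof.
have [D0 near] := guess_near_geodesic.
exists (10 * h + 6 * D0) => x y z w.
have [p [Lp [q Lq pq] [r Lr pr]]] : exists p, [/\ L x y p,
    (exists2 q, L x w q & d p q <= 2 * h) &
    exists2 r, L w y r & d p r <= 2 * h].
  apply: contrapT => no_p.
  have dxx a : d a a = 0.
    by have [f [f0 _ ff]] := d_geod a a; have := ff 0 0 isT; rewrite f0.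
  have := @L_conn x y (fun p => exists2 q, L x w q & d p q <= h).
  case.
  - by exists x; [exact: L_l | rewrite dxx].
  - move=> p p' Lp Lp' pp' [q Lq pq].
    have [r [Lr|Lr] pr] := L_thin w Lp'; first by exists r.
    exfalso; apply: no_p; exists p; split=> //.
      by exists q => //; lia.
    by exists r => //; have := d_tri p p' r; lia.
  - move=> q Lq yq; apply: no_p; exists y; split; first exact: L_r.
      by exists q => //; lia.
    by exists y; [exact: L_r | rewrite dxx].
have [s Ls ps] := L_thin z Lp.
have := near _ _ _ Lq; have := near _ _ _ Lr.
have := d_tri p q w; have := d_tri p r w; have := d_tri x q p.
have := d_tri y r p; have := d_tri s p w.
rewrite (d_sym q p) (d_sym r p) (d_sym s p) (d_sym y p) (d_sym y r) (d_sym w y).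
rewrite (d_sym w r).
case: Ls => /near; [have := d_tri x s w | have := d_tri y s w];
  have := d_tri z s w; have := d_tri x p y; rewrite (d_sym z s) (d_sym p y) ?(d_sym y s);
  have := d_sym x p; have := d_sym y p; have := d_sym s y; lia.
Qed.

End GuessingGeodesics.

Local Open Scope group_scope.
Local Open Scope nat_scope.

(** * Word metrics *)

Section WordMetric.
Variables (G : groupType) (S : seq G) (genS : generates S).
Implicit Types (g x y z w : G).
Notation wl := (word_length genS).
Notation d := (word_dist genS).

Lemma eval_word_cat (u v : word G) :
  eval_word (u ++ v) = (eval_word u * eval_word v)%g.
Proof. by rewrite /eval_word big_cat. Qed.

Lemma eval_word_inv (u : word G) : eval_word (word_inv u) = (eval_word u)^-1%g.
Proof.
elim: u => [|[x b] u IH]; first by rewrite /eval_word !big_nil invg1.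
rewrite /word_inv /= rev_cons -cats1 eval_word_cat -/(word_inv u) IH.
rewrite /eval_word big_seq1 big_cons /= invgM; congr (_ * _)%g.
by case: b => //=; rewrite invgK.
Qed.

Lemma word_length_spelled g : spelled S g (wl g).
Proof. by rewrite /word_length; case: ex_minnP => n /asboolP. Qed.

Lemma word_length_min g n : spelled S g n -> wl g <= n.
Proof. by move=> gn; rewrite /word_length; case: ex_minnP => k _; apply; apply/asboolP. Qed.

Lemma word_length1 : wl 1 = 0.
Proof.
apply/eqP; rewrite -leqn0; apply: word_length_min; exists [::]; split=> //.
by rewrite /eval_word big_nil.
Qed.

Lemma word_lengthM x y : wl (x * y)%g <= wl x + wl y.
Proof.
have [u [su uS ux]] := word_length_spelled x.
have [v [sv vS vy]] := word_length_spelled y.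
apply: word_length_min; exists (u ++ v); split.
- by rewrite size_cat su sv.
- by move=> a; rewrite mem_cat => /orP [/uS|/vS].
- by rewrite eval_word_cat ux vy.
Qed.

Lemma word_lengthV_le x : wl x^-1%g <= wl x.
Proof.
have [u [su uS ux]] := word_length_spelled x.
apply: word_length_min; exists (word_inv u); split.
- by rewrite /word_inv size_rev size_map.
- by move=> a; rewrite /word_inv mem_rev => /mapP [b /uS bS ->].
- by rewrite eval_word_inv ux.
Qed.

Lemma word_lengthV x : wl x^-1%g = wl x.
Proof.
apply/eqP; rewrite eqn_leq word_lengthV_le /=.
by rewrite -{1}(invgK x) word_lengthV_le.
Qed.

Lemma word_length_gen x : x \in S -> wl x <= 1.
Proof.
move=> xS; apply: word_length_min; exists [:: (x, false)]; split=> //.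
  by move=> a; rewrite inE => /eqP ->.
by rewrite /eval_word big_seq1.
Qed.

Lemma word_length_le1 x : wl x <= 1 -> x = 1%g \/ exists2 s, s \in S & x = s \/ x = s^-1%g.
Proof.
have [u [<- uS <-]] := word_length_spelled x.
case: u uS => [|[s b] [|//]] uS _; first by left; rewrite /eval_word big_nil.
right; exists s; first exact: (uS (s, b) (mem_head _ _)).
by rewrite /eval_word big_seq1; case: b {uS}; [right|left].
Qed.

Lemma word_dist_sym x y : d x y = d y x.
Proof. by rewrite /word_dist -word_lengthV invgM invgK. Qed.

Lemma word_dist_tri x y z : d x z <= d x y + d y z.
Proof.
rewrite /word_dist; apply: leq_trans (word_lengthM _ _).
by rewrite mulgA mulgK.
Qed.

Lemma word_distM g x y : d (g * x)%g (g * y)%g = d x y.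
Proof. by rewrite /word_dist invgM -mulgA mulKg. Qed.

Lemma word_dist_geod x y : exists c : nat -> G,
  [/\ c 0 = x, c (d x y) = y &
      forall i j, i <= j <= d x y -> d (c i) (c j) = j - i].
Proof.
have [u [su uS ux]] := word_length_spelled (x^-1 * y)%g.
rewrite -/(d x y) in su.
pose c i := (x * eval_word (take i u))%g.
have c0 : c 0 = x by rewrite /c take0 /eval_word big_nil mulg1.
have cn : c (d x y) = y by rewrite /c -su take_size ux mulVKg.
have up i j : i <= j <= d x y -> d (c i) (c j) <= j - i.
  move=> ij; rewrite word_distM /word_dist.
  have -> : take j u = take i u ++ drop i (take j u).
    by rewrite -{1}(cat_take_drop i (take j u)) take_takel //; lia.
  rewrite eval_word_cat mulKg; apply: word_length_min.
  exists (drop i (take j u)); split=> //.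
    by rewrite size_drop size_take; case: ltnP; lia.
  by move=> a /mem_drop /mem_take /uS.
exists c; split=> // i j ij; apply/eqP; rewrite eqn_leq up //=.
have := word_dist_tri x (c i) y; have := word_dist_tri (c i) (c j) y.
have := up 0 i; have := up j (d x y); rewrite c0 cn; lia.
Qed.

End WordMetric.

Section FourPoint.
Import Order.TTheory GRing.Theory Num.Theory.
Variable G : groupType.

(** Clearing the halves moves the condition to the naturals. The truncated subtractions are exact by
    the triangle inequality. *)
Lemma word_hyperbolicP : word_hyperbolic G <->
  exists (S : seq G) (genS : generates S) (D : nat), forall x y z w : G,
  let d := word_dist genS in
  minn (d x w + d z w - d x z) (d z w + d y w - d z y) + d x y
    <= d x w + d y w + D.
Proof.
have sub_tri (S : seq G) (genS : generates S) (x z w : G) :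
      (((word_dist genS x w)%:R + (word_dist genS z w)%:R
        - (word_dist genS x z)%:R) : rat)%R =
      (word_dist genS x w + word_dist genS z w - word_dist genS x z)%:R%R.
  rewrite natrB ?natrD //.
  by have := word_dist_tri genS x w z; rewrite (word_dist_sym _ w z).
split=> [[S [genS [delta [d0 hyp]]]]|[S [genS [D hyp]]]].
  have [D hD] : exists D : nat, (delta *+ 2 <= D%:R)%R.
    by exists (Num.trunc (delta *+ 2)%R).+1; apply: ltW; apply: truncnS_gt.
  exists S, genS, D => x y z w /=; have := hyp x y z w.
  rewrite /gromov_product !sub_tri.
  set a := (_ + _ - word_dist genS x z); set b := (_ + _ - word_dist genS z y).
  set c := (_ + _ - word_dist genS x y).
  have : c + word_dist genS x y = word_dist genS x w + word_dist genS y w.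
    have := word_dist_tri genS x w y; rewrite /c (word_dist_sym _ w y); lia.
  move=> <- hab; suff : minn a b <= c + D by lia.
  have [ab|ab] := leqP a b.
    move: hab; rewrite min_l; last by rewrite ler_pdivrMr // divfK // ler_nat.
    by move=> hab; rewrite -(ler_nat rat) natrD; lra.
  move: hab; rewrite min_r; last by rewrite ler_pdivrMr // divfK // ler_nat ltnW.
  by move=> hab; rewrite -(ler_nat rat) natrD; lra.
exists S, genS, D%:R%R; split=> // x y z w; have := hyp x y z w => /=.
rewrite /gromov_product !sub_tri.
set a := (_ + _ - word_dist genS x z); set b := (_ + _ - word_dist genS z y).
set c := (_ + _ - word_dist genS x y).
have : c + word_dist genS x y = word_dist genS x w + word_dist genS y w.
  have := word_dist_tri genS x w y; rewrite /c (word_dist_sym _ w y); lia.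
move=> <- hab; have : minn a b <= c + D by lia.
have [ab|ab] := leqP a b.
  rewrite min_l; last by rewrite ler_pdivrMr // divfK // ler_nat.
  rewrite -(ler_nat rat) natrD; have : (0 <= D%:R :> rat)%R by []. lra.
rewrite min_r; last by rewrite ler_pdivrMr // divfK // ler_nat ltnW.
rewrite -(ler_nat rat) natrD; have : (0 <= D%:R :> rat)%R by []. lra.
Qed.

End FourPoint.

(** * Abelian subgroups of hyperbolic groups *)

Section FlatPlane.
Variables (G : groupType) (S : seq G) (genS : generates S) (D : nat).
Notation wl := (word_length genS).
Notation d := (word_dist genS).
Hypothesis four_point : forall x y z w : G,
  minn (d x w + d z w - d x z) (d z w + d y w - d z y) + d x y
    <= d x w + d y w + D.

Fixpoint ball_seq (r : nat) : seq G :=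
  if r is r'.+1 then
    1%g :: [seq (a * x)%g | a <- S ++ [seq s^-1%g | s <- S], x <- ball_seq r']
  else [:: 1%g].

Lemma ball_seqP r g : wl g <= r -> g \in ball_seq r.
Proof.
have [u [<- uS <-]] := word_length_spelled genS g.
elim: r u uS {g} => [|r IH] [|a u] uS //=; rewrite ?in_nil //.
- by rewrite /eval_word big_nil inE.
- by rewrite /eval_word big_nil inE eqxx.
rewrite ltnS => ur; rewrite inE; apply/orP; right.
rewrite /eval_word big_cons; apply: allpairs_f; last first.
  by apply: IH ur => b bu; apply: uS; rewrite inE bu orbT.
have aS := uS a (mem_head _ _); rewrite mem_cat.
by case: (a.2); rewrite ?aS //; apply/orP; right; rewrite map_f.
Qed.

(* [g] maps the geodesic from 1 to [h] to one from [g] to [h * g], whose ends are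
   close to those of the first one: away from the ends, the two fellow-travel. *)
Lemma commuting_shift (g h : G) (R : nat) (c : nat -> G) :
  commute g h -> wl g <= R -> c 0 = 1%g -> c (wl h) = h ->
  (forall i j, i <= j <= wl h -> d (c i) (c j) = j - i) ->
  2 * (R + 2 * D + 1) <= wl h ->
  let k := R + 2 * D + 1 in
  exists2 k', k <= k' + R <= k + R + R & d (c k) (g * c k')%g <= 4 * D.
Proof.
move=> gh gR c0 cn cc hR k.
(* The symmetric four-point condition: each of the three sums of opposite distances is at most the
   larger of the other two, plus [D]. *)
have S4 x y z w : d x y + d z w <= maxn (d x z + d y w) (d z y + d x w) + D.
  have := four_point x y z w; have := word_dist_sym genS.
  have := word_dist_tri genS x w z; have := word_dist_tri genS z w y.
  move=> t1 t2 sy; rewrite (sy w z) in t2; rewrite (sy w y) in t1; lia.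
set n := wl h in cn cc hR; pose q := (g * h)%g.
have d1 x : d 1%g x = wl x by rewrite /word_dist invg1 mul1g.
have dgq : d g q = n by rewrite /word_dist mulKg.
have dhq : d h q <= R by rewrite /word_dist /q gh mulKg.
have d1g : d 1%g g <= R by rewrite d1.
have d1h : d 1%g h = n by rewrite d1.
have d1x : d 1%g (c k) = k by rewrite -c0 cc; lia.
have dxh : d (c k) h = n - k by rewrite -cn cc; lia.
have sy := word_dist_sym genS.
have dgh1 : n <= d g h + R by have := word_dist_tri genS 1%g g h; lia.
have xg : d (c k) g + n <= k + d g h + D.
  by have := S4 (c k) g 1%g h; rewrite d1h (sy (c k) 1%g) d1x dxh; lia.
have xq : d (c k) q + d g h <= n + n - k + D.
  have := S4 (c k) q g h; rewrite dgq dxh (sy q h).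
  have := word_dist_tri genS g 1%g h; rewrite (sy g 1%g) d1h; lia.
have dxg_lo : k <= d (c k) g + R.
  by have := word_dist_tri genS 1%g g (c k); rewrite (sy g (c k)); lia.
have dxg_hi : d (c k) g <= k + R.
  by have := word_dist_tri genS (c k) 1%g g; rewrite (sy _ 1%g); lia.
(* The companion of [c k] is the point of the translated geodesic at the same distance from [g]. *)
exists (d (c k) g); first lia.
have := S4 (c k) (g * c (d (c k) g))%g g q; rewrite dgq.
set k' := d (c k) g in xg xq dxg_lo dxg_hi *.
have -> : d g (g * c k')%g = k'.
  by rewrite -{1}(mulg1 g) word_distM -c0 cc; lia.
have -> : d (g * c k')%g q = n - k'.
  by rewrite word_distM -cn cc; lia.
lia.
Qed.

(* By [commuting_shift], the ball of radius R of an abelian subgroup has only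
   O(R) elements, whereas it would have at least c R^2 of them here. *)
Lemma no_flat_plane (a b : G) : commute a b ->
  ~ (forall m n m' n', (a ^+ m * b ^+ n = a ^+ m' * b ^+ n')%g -> m = m' /\ n = n').
Proof.
move=> ab inj.
have wlX (x : G) n : wl (x ^+ n)%g <= n * wl x.
  elim: n => [|n IH]; first by rewrite expg0 word_length1.
  by rewrite expgS mulSn; apply: leq_trans (word_lengthM _ _ _) _; rewrite leq_add2l.
have far r : exists m, r < wl (a ^+ m)%g.
  apply: contrapT => nex.
  have le m : wl (a ^+ m)%g <= r.
    by rewrite leqNgt; apply/negP => lt; apply: nex; exists m.
  pose s := [seq (a ^+ m)%g | m <- iota 0 (size (ball_seq r)).+1].
  have us : uniq s.
    rewrite map_inj_uniq ?iota_uniq // => m m' E.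
    by have [] := inj m 0 m' 0; rewrite ?E.
  have : size s <= size (ball_seq r).
    by apply: uniq_leq_size => // x /mapP [m _ ->]; apply: ball_seqP.
  by rewrite size_map size_iota ltnn.
pose l := maxn (wl a) (wl b); pose B := ball_seq (4 * D).
(* [M] is chosen so that [M * M] exceeds [(2 * R).+1 * size B], the number of codes given to the
   [M * M] elements below. *)
pose M := (4 * l + 1) * size B + 1; pose R := 2 * l * M.
have short m n : m < M -> n < M -> wl (a ^+ m * b ^+ n)%g <= R.
  move=> mM nM; apply: leq_trans (word_lengthM _ _ _) _.
  have := wlX a m; have := wlX b n.
  have : m * wl a <= M * l by apply: leq_mul; rewrite /l; lia.
  have : n * wl b <= M * l by apply: leq_mul; rewrite /l; lia.
  rewrite /R; lia.
pose k := R + 2 * D + 1.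
have [e he] := far (2 * k); pose h := (a ^+ e)%g.
have [c []] := word_dist_geod genS 1%g h.
have d1h : d 1%g h = wl h by rewrite /word_dist invg1 mul1g.
rewrite d1h => c0 cn cc.
(* An element is recovered from the index of the companion of [c k], which varies in a window of
   width [2 * R], and from the error in the ball [B]. *)
have shift (i : 'I_M * 'I_M) : exists j : 'I_(2 * R).+1 * 'I_(size B),
    (a ^+ i.1 * b ^+ i.2)%g = (c k * nth 1%g B j.2 * (c (j.1 + k - R))^-1)%g.
  case: i => m n; set g := (_ * _)%g.
  have gh : commute g h.
    apply/commute_sym/commuteM; first exact/commuteX/commute_sym/commuteX/commute_refl.
    exact/commute_sym/commuteX/commute_sym/commuteX.
  have [|k' kk' gk'] := commuting_shift gh (short _ _ (ltn_ord m) (ltn_ord n)) c0 cn cc.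
    by rewrite -/h in he; rewrite /k in he; lia.
  rewrite -/k in kk' gk'.
  have j1 : k' + R - k < (2 * R).+1 by lia.
  have inB := ball_seqP gk'; rewrite -/B in inB.
  have j2 : index ((c k)^-1 * (g * c k'))%g B < size B by rewrite index_mem.
  exists (Ordinal j1, Ordinal j2) => /=.
  have -> : k' + R - k + k - R = k' by lia.
  by rewrite nth_index // mulVKg mulgK.
have [f fP] := choice shift.
have finj : injective f.
  move=> i j fij; have := fP i; rewrite fij -fP => /inj [E1 E2].
  by case: i j E1 E2 {fij} => [i1 i2] [j1 j2] /= /val_inj -> /val_inj ->.
have := leq_card f finj; rewrite !card_prod !card_ord /R /M.
set s := size B; nia.
Qed.

End FlatPlane.

Lemma flat_plane_not_hyperbolic (G : groupType) (a b : G) : commute a b ->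
  (forall m n m' n', (a ^+ m * b ^+ n = a ^+ m' * b ^+ n')%g -> m = m' /\ n = n') ->
  ~ word_hyperbolic G.
Proof.
move=> ab inj /word_hyperbolicP [S [genS [D hyp]]].
exact: (@no_flat_plane G S genS D hyp a b ab inj).
Qed.

(** * Normal forms in graph products *)

Section Syllables.
Variables (N : nat) (adj : rel 'I_N) (m : 'I_N -> nat).
Hypothesis adj_sym : symmetric adj.
Hypothesis adj_irr : irreflexive adj.
Hypothesis m_gt1 : forall i, 1 < m i.
Implicit Types (u v x : 'I_N) (w : seq ('I_N * nat)).

Let adjF u v : adj u v -> (u == v) = false.
Proof. by apply: contraTF => /eqP ->; rewrite adj_irr. Qed.

(* Left multiplication of a syllable word by [v ^+ k]: the new syllable moves
   to the right past commuting ones until it meets a [v]-syllable to merge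
   with, or a letter that does not commute with [v]. *)
Fixpoint ins v k w : seq ('I_N * nat) :=
  if w is (x, l) :: w' then
    if x == v then
      if (k + l) %% m v == 0 then w' else (v, (k + l) %% m v) :: w'
    else if adj x v then (x, l) :: ins v k w'
    else if k == 0 then w else (v, k) :: w
  else if k == 0 then [::] else [:: (v, k)].

(* The exponent of the [v]-syllable that can be shuffled to the front of [w],
   and 0 if there is none. *)
Fixpoint hdw v w : nat :=
  if w is (x, l) :: w' then
    if x == v then l else if adj x v then hdw v w' else 0
  else 0.

Fixpoint redw w : bool :=
  if w is (x, l) :: w' then [&& 0 < l < m x, hdw x w' == 0 & redw w'] else true.

(** Equality in the trace monoid of syllables: normal forms are unique only modulo these
    commutations. *)
Inductive shuf : seq ('I_N * nat) -> seq ('I_N * nat) -> Prop :=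
  | shuf_refl w : shuf w w
  | shuf_swap a b w : adj a.1 b.1 -> shuf (a :: b :: w) (b :: a :: w)
  | shuf_cons a w w' : shuf w w' -> shuf (a :: w) (a :: w')
  | shuf_trans w1 w2 w3 : shuf w1 w2 -> shuf w2 w3 -> shuf w1 w3.

Lemma shuf_sym w w' : shuf w w' -> shuf w' w.
Proof.
elim=> {w w'} [w|a b w ab|a w w' _|w1 w2 w3 _ s21 _ s32].
- exact: shuf_refl.
- by apply: shuf_swap; rewrite adj_sym.
- exact: shuf_cons.
- exact: shuf_trans s32 s21.
Qed.

Lemma shuf_perm w w' : shuf w w' -> perm_eq w w'.
Proof.
elim=> {w w'} [w|a b w ab|a w w' _ IH|w1 w2 w3 _ s21 _ s32] //.
- by rewrite -[a :: b :: w]/([:: a] ++ [:: b] ++ w) perm_catCA perm_refl.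
- by rewrite perm_cons.
- exact: perm_trans s21 s32.
Qed.

Lemma hdw_shuf v w w' : shuf w w' -> hdw v w = hdw v w'.
Proof.
elim=> {w w'} [//|[u k] [x l] w /= ux|[u k] w w' _ /= -> //|w1 w2 w3 _ -> _ -> //].
have [<-|uv] := eqVneq u v; first by rewrite [x == u]eq_sym (adjF ux) adj_sym ux.
have [<-|xv] := eqVneq x v; first by rewrite ux.
by case: (adj u v); case: (adj x v).
Qed.

Lemma redw_shuf w w' : shuf w w' -> redw w = redw w'.
Proof.
elim=> {w w'} [//|[u k] [x l] w /= ux|[u k] w w' s /= ->|w1 w2 w3 _ -> _ -> //].
  rewrite [adj x u]adj_sym ux (adjF ux) [x == u]eq_sym (adjF ux).
  by case: (0 < k < m u); case: (0 < l < m x); case: (hdw u w == 0); rewrite ?andbF.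
by rewrite (hdw_shuf _ s).
Qed.

Lemma ins_shuf v k w w' : shuf w w' -> shuf (ins v k w) (ins v k w').
Proof.
elim=> {w w'} [w|[u a] [x b] w /= ux|[u a] w w' s IH /=|w1 w2 w3 _ s1 _ s2].
- exact: shuf_refl.
- have xu : adj x u by rewrite adj_sym.
  have [<-|uv] := eqVneq u v.
    rewrite [x == u]eq_sym (adjF ux) xu ?eqxx.
    by case: ifP => _; [apply: shuf_refl | apply: shuf_swap].
  have [<-|xv] := eqVneq x v.
    by rewrite ux; case: ifP => _; [apply: shuf_refl | apply: shuf_swap].
  have [uv'|uv'] := boolP (adj u v); have [xv'|xv'] := boolP (adj x v).
  + exact: shuf_swap.
  + case: ifP => _; first exact: shuf_swap.
    apply: shuf_trans (@shuf_swap (u, a) (v, k) _ uv') _.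
    by apply: shuf_cons; apply: shuf_swap.
  + case: ifP => _; first exact: shuf_swap.
    apply: shuf_sym; apply: shuf_trans (@shuf_swap (x, b) (v, k) _ xv') _.
    by apply: shuf_cons; apply: shuf_swap.
  + by case: ifP => _; [|apply: shuf_cons]; apply: shuf_swap.
- case: ifP => _; first by case: ifP => _; [|apply: shuf_cons].
  case: ifP => _; first exact: shuf_cons.
  by case: ifP => _; do ?apply: shuf_cons.
- exact: shuf_trans s1 s2.
Qed.

Lemma hdw_lt v w : redw w -> hdw v w < m v.
Proof.
elim: w => [|[x l] w IH] /=; first by have := m_gt1 v; lia.
case/and3P=> /andP [_ lm] _ rw; have := m_gt1 v.
case: eqP => [<-//|_] v1; case: ifP => _; [exact: IH | lia].
Qed.

Lemma hdw_ins v k w : redw w -> k < m v -> hdw v (ins v k w) = (k + hdw v w) %% m v.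
Proof.
move=> + km; elim: w => [_|[x l] w IH] /=.
  by rewrite addn0 modn_small //; case: eqP => [->//|_] /=; rewrite eqxx.
case/and3P=> lm /eqP h0 rw.
have [E|xv] := eqVneq x v.
  by subst x; case: eqP => [->//|_] /=; rewrite eqxx.
case: ifP => xv' /=.
  by rewrite (negPf xv) xv' IH.
case: eqP => [->|_] /=; first by rewrite (negPf xv) xv' mod0n.
by rewrite eqxx addn0 modn_small.
Qed.

Lemma hdw_ins_adj u v k w : adj u v -> hdw u (ins v k w) = hdw u w.
Proof.
move=> uv; have vu : adj v u by rewrite adj_sym.
elim: w => [|[x l] w IH] /=.
  by case: eqP => //= _; rewrite (adjF vu) vu.
have [->|xv] := eqVneq x v.
  by rewrite (adjF vu) vu; case: eqP => //= _; rewrite (adjF vu) vu.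
case: ifP => xv' /=; first by rewrite IH.
by case: eqP => //= _; rewrite (adjF vu) vu.
Qed.

Lemma hdw_ins_far u v k w : u != v -> ~~ adj u v ->
  (k + hdw v w) %% m v != 0 -> hdw u (ins v k w) = 0.
Proof.
move=> uv; rewrite adj_sym => vu; elim: w => [|[x l] w IH] /=.
  by case: (k == 0) => //= _; rewrite eq_sym (negPf uv) (negPf vu).
have [_|xv] := eqVneq x v.
  by move/negPf=> -> /=; rewrite eq_sym (negPf uv) (negPf vu).
case: ifP => xv' /=.
  have [E|_] := eqVneq x u; first by rewrite E adj_sym (negPf vu) in xv'.
  by move/IH=> ->; case: ifP.
case: (eqVneq k 0) => [->|_]; first by rewrite mod0n.
by move=> _ /=; rewrite [v == u]eq_sym (negPf uv) (negPf vu).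
Qed.

Lemma redw_ins v k w : redw w -> k < m v -> redw (ins v k w).
Proof.
move=> + km; elim: w => [_|[x l] w IH] /=.
  by case: (posnP k) => //= -> ; rewrite km.
move=> rw; have [E|xv] := eqVneq x v.
  subst x; case: eqP => [_|/eqP r0] /=; first by case/and3P: rw.
  case/and3P: rw => _ -> ->; rewrite lt0n r0 ltn_mod /=.
  by have := m_gt1 v; lia.
case: ifP => xv' /=.
  case/and3P: rw => -> h0 rw; rewrite IH // andbT /=.
  by rewrite hdw_ins_adj.
by case: posnP => //= ->; rewrite km (negPf xv) xv' eqxx /=.
Qed.

Lemma ins0 v w : redw w -> ins v 0 w = w.
Proof.
elim: w => //= -[x l] w IH /and3P [/andP [l0 lm] _ rw].
case: eqP => [E|_]; last by rewrite IH //; case: ifP.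
by subst x; rewrite add0n modn_small // (negPf (lt0n_neq0 l0)).
Qed.

Lemma ins_push v k w : redw w -> hdw v w = 0 -> 0 < k ->
  shuf (ins v k w) ((v, k) :: w).
Proof.
move=> + + k0; elim: w => [|[x l] w IH] /=.
  by move=> _ _; rewrite (negPf (lt0n_neq0 k0)); apply: shuf_refl.
case/and3P=> /andP [l0 lm] _ rw; case: eqP => [_ E|_]; first by rewrite E in l0.
case: ifP => [xv h0|_ _]; last by rewrite (negPf (lt0n_neq0 k0)); apply: shuf_refl.
by apply: shuf_trans (shuf_cons _ (IH rw h0)) _; apply: shuf_swap.
Qed.

Lemma shuf_head v w : hdw v w != 0 -> exists w', shuf w ((v, hdw v w) :: w').
Proof.
elim: w => [//|[x l] w IH] /=.
case: (x =P v) => [->|_]; first by exists w; apply: shuf_refl.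
move: IH; case: ifP => // xv IH h0.
have [//|w' s] := IH; exists ((x, l) :: w').
by apply: shuf_trans (shuf_cons _ s) _; apply: shuf_swap.
Qed.

(** Only up to [shuf]: if the inner insertion cancels the [v]-syllable, the outer one may put a new
    syllable at another place. *)
Lemma ins_add v a b w : redw w -> a < m v -> b < m v ->
  shuf (ins v a (ins v b w)) (ins v ((a + b) %% m v) w).
Proof.
move=> rw am bm; have [h0|h0] := eqVneq (hdw v w) 0.
  have [->|b0] := posnP b; first by rewrite ins0 // addn0 modn_small //; apply: shuf_refl.
  apply: shuf_trans (ins_shuf _ _ (ins_push rw h0 b0)) _ => /=.
  rewrite eqxx; case: eqP => [->|/eqP r0]; first by rewrite ins0 //; apply: shuf_refl.
  by apply/shuf_sym/ins_push; rewrite ?lt0n.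
have [w' s] := shuf_head h0; set l := hdw v w in s.
have := rw; rewrite (redw_shuf s) /= => /and3P [/andP [l0 lm] /eqP h' rw'].
apply: shuf_trans (ins_shuf _ _ (ins_shuf _ _ s)) _.
apply: shuf_sym; apply: shuf_trans (ins_shuf _ _ s) _ => /=; rewrite eqxx.
rewrite modnDml -addnA -modnDmr; case: (eqVneq ((b + l) %% m v) 0) => [->|r0] /=.
  rewrite addn0 modn_small //; have [->|a0] := posnP a.
    by rewrite ins0 //; apply: shuf_refl.
  exact/shuf_sym/ins_push.
by rewrite eqxx; apply: shuf_refl.
Qed.

Lemma ins_comm u v a b w : adj u v ->
  shuf (ins u a (ins v b w)) (ins v b (ins u a w)).
Proof.
move=> uv; have vu : adj v u by rewrite adj_sym.
have uvF := adjF uv; have vuF := adjF vu.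
elim: w => [|[x l] w IH] /=.
  case: (eqVneq a 0) => a0; case: (eqVneq b 0) => b0 //=;
    rewrite ?uvF ?vuF ?uv ?vu ?a0 ?b0 ?(negPf a0) ?(negPf b0) ?eqxx /=; try exact: shuf_refl.
  exact: shuf_swap.
have [->|xu] := eqVneq x u.
  by rewrite uvF uv /= eqxx; case: ifP => _ /=; rewrite ?uvF ?uv; apply: shuf_refl.
have [->|xv] := eqVneq x v.
  by rewrite vu /= eqxx; case: ifP => _ /=; rewrite ?vuF ?vu; apply: shuf_refl.
case: (boolP (adj x u)) => [xu'|/negPf xu']; case: (boolP (adj x v)) => [xv'|/negPf xv'] /=.
- by rewrite (negPf xu) (negPf xv) xu' xv'; apply: shuf_cons.
- rewrite (negPf xv) xv'; case: eqP => _ /=; rewrite ?(negPf xu) ?xu' ?vuF ?vu.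
    exact: shuf_refl.
  exact: shuf_refl.
- rewrite (negPf xu) xu'; case: eqP => _ /=; rewrite ?(negPf xv) ?xv' ?uvF ?uv.
    exact: shuf_refl.
  exact: shuf_refl.
- case: (eqVneq a 0) => a0; case: (eqVneq b 0) => b0 //=;
    rewrite ?uvF ?vuF ?uv ?vu ?a0 ?b0 ?(negPf a0) ?(negPf b0) 
    ?(negPf xu) ?xu' ?(negPf xv) ?xv' ?eqxx /=; try exact: shuf_refl.
  exact: shuf_swap.
Qed.

Definition expo (a : 'I_N * bool) : nat := if a.2 then (m a.1).-1 else 1.

Lemma expo_lt a : expo a < m a.1.
Proof. by have := m_gt1 a.1; rewrite /expo; case: ifP; lia. Qed.

Definition actw (z : seq ('I_N * nat)) (u : word 'I_N) : seq ('I_N * nat) :=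
  foldr (fun a => ins a.1 (expo a)) z u.

Lemma redw_act (u : word _) z : redw z -> redw (actw z u).
Proof. by move=> rz; elim: u => //= a u IH; apply: redw_ins => //; apply: expo_lt. Qed.

Lemma act_shuf (u : word _) z z' : shuf z z' -> shuf (actw z u) (actw z' u).
Proof. by move=> s; elim: u => //= a u IH; apply: ins_shuf. Qed.

Lemma act_nseq i n z : redw z ->
  shuf (actw z (nseq n (i, false))) (ins i (n %% m i) z).
Proof.
move=> rz; elim: n => [|n IH] /=; first by rewrite mod0n ins0 //; apply: shuf_refl.
apply: shuf_trans (ins_shuf _ _ IH) _.
have -> : n.+1 %% m i = (1 + n %% m i) %% m i by rewrite modnDmr.
by apply: ins_add; rewrite // ltn_mod; have := m_gt1 i; lia.
Qed.

(** Van der Waerden's method: words act on reduced words modulo [shuf], and both sides of each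
    relation act alike. Hence the normal form of a word depends only on the group element. *)
Lemma act_pres_eq (u u' : word _) : pres_eq (graph_product_rels adj m) u u' ->
  forall z z', redw z -> shuf z z' -> shuf (actw z u) (actw z' u').
Proof.
elim=> {u u'} [u|u v _ IH|u v w _ IH1 _ IH2|u u' v v' _ IH1 _ IH2|i b|u u' r] z z' rz zz'.
- exact: act_shuf.
- apply: shuf_sym; apply: IH; first by rewrite -(redw_shuf zz').
  exact: shuf_sym.
- exact: shuf_trans (IH1 _ _ rz (shuf_refl _)) (IH2 _ _ rz zz').
- rewrite /actw !foldr_cat; apply: IH1; first exact: redw_act.
  exact: IH2.
- apply: shuf_trans (ins_add rz (expo_lt (i, b)) (expo_lt (i, ~~ b))) _.
  have -> : (expo (i, b) + expo (i, ~~ b)) %% m i = 0.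
    have -> : expo (i, b) + expo (i, ~~ b) = m i; last by rewrite modnn.
    by have := m_gt1 i; rewrite /expo /=; case: b => /=; lia.
  by rewrite ins0.
- case: r => [i|j k jk].
    by apply: shuf_trans (act_nseq _ _ rz) _; rewrite modnn ins0.
  rewrite /=; apply: shuf_trans (ins_comm _ _ _ jk) _.
  by do 2!apply: ins_shuf.
Qed.

End Syllables.

Local Open Scope group_scope.

(** * Automorphisms, torsion elements and maps out of a presentation *)

Section Automorphisms.
Variable G : groupType.
Implicit Types (f : aut G) (x y g : G).

Lemma morph_one (h : G -> G) : {morph h : x y / x * y} -> h 1 = 1.
Proof. by move=> hM; apply: (mulgI (h 1)); rewrite -hM !mulg1. Qed.

Lemma morph_exp (h : G -> G) n x : {morph h : x y / x * y} -> h (x ^+ n) = h x ^+ n.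
Proof.
by move=> hM; elim: n => [|n IH]; rewrite ?expg0 ?morph_one // !expgS hM IH.
Qed.

Lemma autM f x y : f (x * y) = f x * f y. Proof. exact: aut_funM. Qed.

Lemma aut1 f : f 1 = 1.
Proof. exact/morph_one/autM. Qed.

Lemma autV f x : f x^-1 = (f x)^-1.
Proof. by apply/esym/mulg1_eq; rewrite -autM mulgV aut1. Qed.

Lemma autX f x n : f (x ^+ n) = f x ^+ n.
Proof. exact/morph_exp/autM. Qed.

Lemma aut_inj f : injective f. Proof. exact: can_inj (@aut_funK _ f). Qed.

Lemma aut_commute f x y : commute (f x) (f y) <-> commute x y.
Proof. by rewrite /commute -!autM; split=> [/aut_inj|->]. Qed.

Definition inner g : aut G.
Proof.
refine (@Aut _ (fun x => g * x * g^-1) (fun x => g^-1 * x * g) _ _ _).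
- by move=> x y; rewrite !mulgA mulgVK.
- by move=> x; rewrite !mulgA mulVg mul1g mulgVK.
- by move=> x; rewrite !mulgA mulgV mul1g mulgK.
Defined.

Lemma innerE g x : inner g x = g * x * g^-1. Proof. by []. Qed.

Lemma autmulE f h x : (f * h) x = f (h x). Proof. by []. Qed.

Lemma innerM g h : inner (g * h) = inner g * inner h.
Proof. by apply: aut_eqP => x; rewrite autmulE !innerE invgM !mulgA. Qed.

Lemma inner1 : inner 1 = 1.
Proof. by apply: aut_eqP => x; rewrite innerE mul1g invg1 mulg1. Qed.

Lemma innerX g n : inner g ^+ n = inner (g ^+ n).
Proof. by elim: n => [|n IH]; rewrite ?expg0 ?inner1 // !expgS IH innerM. Qed.

Lemma innerV g : inner g^-1 = (inner g)^-1.
Proof. by apply/esym/mulg1_eq; rewrite -innerM mulgV inner1. Qed.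

Definition torsion x : Prop := exists2 n, 0 < n & x ^+ n = 1.

Lemma torsion_conj g x : torsion x -> torsion (g^-1 * x * g).
Proof.
case=> n n0 xn; exists n => //.
have -> : g^-1 * x * g = x ^ g by rewrite /conjg mulgA.
by rewrite -conjXg xn conj1g.
Qed.

Lemma torsionV x : torsion x -> torsion x^-1.
Proof. by case=> n n0 xn; exists n; rewrite // expVgn xn invg1. Qed.

Lemma torsionM x y : commute x y -> torsion x -> torsion y -> torsion (x * y).
Proof.
move=> xy [n n0 xn] [k k0 yk]; exists (n * k)%N; first by rewrite muln_gt0 n0.
by rewrite expgMn // expgnA xn expg1n mul1g mulnC expgnA yk expg1n.
Qed.

Lemma torsion_aut f x : torsion x -> torsion (f x).
Proof. by case=> n n0 xn; exists n; rewrite // -autX xn aut1. Qed.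

Lemma commute_conj g x y : commute x y -> commute (g^-1 * x * g) (g^-1 * y * g).
Proof.
have E z : g^-1 * z * g = z ^ g by rewrite conjgE mulgA.
by rewrite /commute !E -!conjMg => ->.
Qed.

End Automorphisms.

Section Spelling.
Variables (H : groupType) (S : seq H).

Lemma spelled1 : spelled S 1 0.
Proof. by exists [::]; split=> //; rewrite /eval_word big_nil. Qed.

Lemma spelledM x y n k : spelled S x n -> spelled S y k -> spelled S (x * y) (n + k).
Proof.
move=> [u [<- uS <-]] [v [<- vS <-]]; exists (u ++ v); split.
- by rewrite size_cat.
- by move=> a; rewrite mem_cat => /orP [/uS|/vS].
- exact: eval_word_cat.
Qed.

Lemma spelled_gen x : x \in S -> spelled S x 1.
Proof.
move=> xS; exists [:: (x, false)]; split=> //; last by rewrite /eval_word big_seq1.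
by move=> a; rewrite inE => /eqP ->.
Qed.

End Spelling.

Section Lifting.
Variables (X : choiceType) (rels : word X -> word X -> Prop).
Variables (K : groupType) (F : X -> K).

Definition word_image (u : word X) : K :=
  eval_word [seq (F a.1, a.2) | a <- u].

Hypothesis F_rels : forall u v, rels u v -> word_image u = word_image v.

Lemma word_image_cat u v : word_image (u ++ v) = word_image u * word_image v.
Proof. by rewrite /word_image map_cat eval_word_cat. Qed.

Lemma word_image_pres u v : pres_eq rels u v -> word_image u = word_image v.
Proof.
elim=> {u v} // [u v w _ -> _ -> //|u u' v v' _ E1 _ E2|x b].
- by rewrite !word_image_cat E1 E2.
- rewrite /word_image /eval_word /= big_cons big_seq1 big_nil.
  by case: b => /=; rewrite ?mulVg ?mulgV.
Qed.

Definition lift_pres (x : presented_group rels) : K := word_image (repr x).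

Lemma lift_presE u : lift_pres (pres_pi rels u) = word_image u.
Proof. exact/word_image_pres/pres_repr. Qed.

Lemma lift_presM : {morph lift_pres : x y / x * y}.
Proof.
move=> x y; have [u ->] := pres_piP x; have [v ->] := pres_piP y.
change (lift_pres (pres_mul (pres_pi rels u) (pres_pi rels v)) =
        lift_pres (pres_pi rels u) * lift_pres (pres_pi rels v)).
by rewrite pres_mulE !lift_presE word_image_cat.
Qed.

End Lifting.

Record labelled_graph := LabelledGraph {
  order : nat;
  edge : rel 'I_order;
  label : 'I_order -> nat;
  edge_sym : symmetric edge;
  edge_irr : irreflexive edge;
  label_gt1 : forall i, (1 < label i)%N
}.

Definition gproduct (G : labelled_graph) : groupType :=
  graph_product (@edge G) (@label G).

#[local] Hint Resolve edge_sym edge_irr label_gt1 : core.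

Section GraphProducts.
Variable G : labelled_graph.
Local Notation N := (order G).
Local Notation adj := (@edge G).
Local Notation m := (@label G).
Local Notation adj_sym := (@edge_sym G).
Local Notation adj_irr := (@edge_irr G).
Local Notation m_gt1 := (@label_gt1 G).
Local Notation W := (gproduct G).

Section NormalForm.
Local Notation pi := (pres_pi (graph_product_rels adj m)).
Implicit Types (u v : 'I_N) (x y : W).

Definition gen v : W := pi [:: (v, false)].

Definition syl v k : W := gen v ^+ k.

Lemma pi_cat (s t : word 'I_N) : pi (s ++ t) = (pi s : W) * (pi t : W).
Proof. by change (pi (s ++ t) = pres_mul (pi s) (pi t)); rewrite pres_mulE. Qed.

Lemma pi_nil : pi [::] = 1 :> W. Proof. by []. Qed.

Lemma syl0 v : syl v 0 = 1. Proof. by []. Qed.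

Lemma syl1 v : syl v 1 = gen v. Proof. by []. Qed.

Lemma sylD v j k : syl v (j + k) = syl v j * syl v k.
Proof. exact: expgnDr. Qed.

Lemma syl_nseq v k : syl v k = pi (nseq k (v, false)).
Proof. by elim: k => // k IH; rewrite /syl expgS -/(syl v k) IH -pi_cat. Qed.

Lemma syl_order v : syl v (m v) = 1.
Proof. by rewrite syl_nseq; apply/pres_piE/pres_eq_rel; constructor. Qed.

Lemma syl_mod v k : syl v (k %% m v) = syl v k.
Proof.
rewrite {2}(divn_eq k (m v)) addnC sylD; set q := (k %/ m v)%N.
by rewrite /syl mulnC expgnA -/(syl v (m v)) syl_order expg1n mulg1.
Qed.

Lemma sylV v k : (k <= m v)%N -> (syl v k)^-1 = syl v (m v - k).
Proof.
by move=> km; apply: mulg1_eq; rewrite -sylD subnKC // syl_order.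
Qed.

Lemma gen_comm u v : adj u v -> commute (gen u) (gen v).
Proof.
move=> uv; rewrite /commute -!pi_cat; apply/pres_piE/pres_eq_rel.
exact: (gp_commute m uv).
Qed.

Lemma syl_comm u v j k : adj u v -> commute (syl u j) (syl v k).
Proof. by move=> uv; apply: commuteX2; apply: gen_comm. Qed.

Definition evs (s : seq ('I_N * nat)) : W :=
  foldr (fun a y => syl a.1 a.2 * y) 1 s.

Lemma evs_ins v k s : evs (ins adj m v k s) = syl v k * evs s.
Proof.
elim: s => [|[x l] s IH] /=.
  by case: eqP => [->|_] /=; rewrite ?mulg1.
case: eqP => [->|_].
  rewrite mulgA -sylD -(syl_mod v (k + l)).
  by case: eqP => [->|_] //=; rewrite syl0 mul1g.
case: ifP => [xv|_] /=.
  by rewrite IH !mulgA (syl_comm _ _ xv).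
by case: eqP => [->|_] //=; rewrite syl0 mul1g.
Qed.

Lemma evs_act (s : word 'I_N) z : evs (actw adj m z s) = pi s * evs z.
Proof.
elim: s => [|[i b] s IH] /=; first by rewrite pi_nil mul1g.
rewrite evs_ins IH -cat1s pi_cat mulgA; congr (_ * _ * _).
case: b => //=; rewrite -[LHS]mul1g.
have <- : pi [:: (i, true)] * gen i = 1.
  by rewrite -pi_cat; apply/pres_piE/(pres_eq_cancel _ i true).
rewrite -mulgA -expgS.
have -> : (expo m (i, true)).+1 = m i by have := m_gt1 i; rewrite /expo /=; lia.
by rewrite -/(syl i (m i)) syl_order mulg1.
Qed.

Definition nf x : seq ('I_N * nat) := actw adj m [::] (repr x).

Lemma nf_red x : redw adj m (nf x).
Proof. exact: redw_act. Qed.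

Lemma nfK x : evs (nf x) = x.
Proof. by rewrite evs_act mulg1 /pres_pi reprK. Qed.

Lemma nf_pi (s : word 'I_N) : shuf adj (nf (pi s)) (actw adj m [::] s).
Proof. by apply: act_pres_eq => //; [apply: pres_repr | constructor]. Qed.

Lemma nf_syl v k x : shuf adj (nf (syl v k * x)) (ins adj m v (k %% m v) (nf x)).
Proof.
have -> : syl v k * x = pi (nseq k (v, false) ++ repr x).
  by rewrite pi_cat -syl_nseq /pres_pi reprK.
apply: shuf_trans (nf_pi _) _; rewrite /actw foldr_cat -/(actw adj m _ _).
by apply: act_nseq => //; apply: nf_red.
Qed.

(** The sector of the wall (1, v) that contains the chamber [x]; sector 0 is that of 1. *)
Definition hd v x : nat := hdw adj v (nf x).
Definition len x : nat := size (nf x).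
Definition supp x : {set 'I_N} := [set v | v \in [seq a.1 | a <- nf x]].

Lemma nf1 : nf 1 = [::].
Proof. by have := perm_size (shuf_perm (nf_pi [::])) => /= /size0nil. Qed.

Lemma hd_lt v x : (hd v x < m v)%N.
Proof. by apply: hdw_lt => //; apply: nf_red. Qed.

Lemma hd1 v : hd v 1 = 0. Proof. by rewrite /hd nf1. Qed.

Lemma len1 : len 1 = 0. Proof. by rewrite /len nf1. Qed.

Lemma supp1 : supp 1 = set0.
Proof. by apply/setP=> v; rewrite /supp nf1 !inE. Qed.

Lemma hd_syl v k x : hd v (syl v k * x) = (k + hd v x) %% m v.
Proof.
rewrite /hd (hdw_shuf adj_sym adj_irr _ (nf_syl v k x)) hdw_ins ?modnDml //.
  exact: nf_red.
by rewrite ltn_mod; have := m_gt1 v; lia.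
Qed.

Lemma hd_syl_adj u v k x : adj u v -> hd u (syl v k * x) = hd u x.
Proof.
by move=> uv; rewrite /hd (hdw_shuf adj_sym adj_irr _ (nf_syl v k x)) hdw_ins_adj.
Qed.

Lemma hd_syl_far u v k x : u != v -> ~~ adj u v ->
  (k + hd v x) %% m v != 0 -> hd u (syl v k * x) = 0.
Proof.
move=> uv nuv kx; rewrite /hd (hdw_shuf adj_sym adj_irr _ (nf_syl v k x)).
by apply: hdw_ins_far => //; rewrite modnDml.
Qed.

Lemma nf_push v k x : (0 < k < m v)%N -> hd v x = 0 ->
  shuf adj (nf (syl v k * x)) ((v, k) :: nf x).
Proof.
move=> /andP [k0 km] h0; apply: shuf_trans (nf_syl v k x) _.
by rewrite modn_small //; apply: (ins_push (m := m)) => //; apply: nf_red.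
Qed.

Lemma len_push v k x : (0 < k < m v)%N -> hd v x = 0 -> len (syl v k * x) = (len x).+1.
Proof. by move=> km h0; rewrite /len (perm_size (shuf_perm (nf_push km h0))). Qed.

Lemma supp_push v k x : (0 < k < m v)%N -> hd v x = 0 ->
  supp (syl v k * x) = v |: supp x.
Proof.
move=> km h0; apply/setP=> u; rewrite !inE.
by rewrite (perm_mem (perm_map _ (shuf_perm (nf_push km h0)))) inE.
Qed.

Lemma nf_evs s : redw adj m s -> shuf adj (nf (evs s)) s.
Proof.
elim: s => [_|[v k] s IH /=]; first by rewrite nf1; constructor.
case/and3P=> km /eqP h0 rs; have s' := IH rs.
apply: shuf_trans (nf_push km _) _; last exact: shuf_cons.
by rewrite /hd (hdw_shuf adj_sym adj_irr _ s').
Qed.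

Lemma syl_ind (P : W -> Prop) : P 1 ->
  (forall v k y, (0 < k < m v)%N -> hd v y = 0 -> P y -> P (syl v k * y)) ->
  forall x, P x.
Proof.
move=> P1 PS x; rewrite -(nfK x); elim: (nf x) (nf_red x) => //= -[v k] s IH.
case/and3P=> km /eqP h0 rs; apply: PS => //; last exact: IH.
by rewrite /hd (hdw_shuf adj_sym adj_irr _ (nf_evs rs)).
Qed.

Lemma hd_split v x : exists2 y, hd v y = 0 & x = syl v (hd v x) * y.
Proof.
exists (syl v (m v - hd v x) * x).
  rewrite hd_syl subnK ?modnn //; exact/ltnW/hd_lt.
by rewrite mulgA -sylD subnKC ?syl_order ?mul1g //; apply/ltnW/hd_lt.
Qed.

Lemma hd_supp v x : hd v x != 0 -> v \in supp x.
Proof.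
have [y y0 E] := hd_split v x => h0.
rewrite E supp_push ?inE ?eqxx // lt0n h0 /=; exact: hd_lt.
Qed.

Lemma hd_ex x : x <> 1 -> exists v, hd v x != 0.
Proof.
elim/syl_ind: x => // v k y km h0 _ _; exists v.
by rewrite hd_syl h0 addn0 modn_small -?lt0n; case/andP: km.
Qed.

End NormalForm.

(** * Walls *)

Section Walls.
Implicit Types (u v a : 'I_N) (x y z g : W).

Lemma label_gt0 v : (0 < m v)%N. Proof. exact: ltnW. Qed.

Lemma modn_lt v k : (k %% m v < m v)%N.
Proof. by rewrite ltn_mod label_gt0. Qed.

Definition star v : {set 'I_N} := [set u | (u == v) || adj u v].

Lemma in_star u v : (u \in star v) = (u == v) || adj u v.
Proof. by rewrite inE. Qed.

Lemma star_sym u v : (u \in star v) = (v \in star u).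
Proof. by rewrite !in_star eq_sym adj_sym. Qed.

Lemma star_refl v : v \in star v. Proof. by rewrite in_star eqxx. Qed.

Lemma notin_star u v : u \notin star v -> u != v /\ ~~ adj u v.
Proof. by rewrite in_star negb_or => /andP. Qed.

Lemma edge_neq u v : adj u v -> u != v.
Proof. by apply: contraTneq => ->; rewrite adj_irr. Qed.

Lemma hd_far u v k x : u \notin star v -> (k + hd v x) %% m v != 0 ->
  hd u (syl v k * x) = 0.
Proof. by move=> /notin_star [uv nuv]; apply: hd_syl_far. Qed.

Lemma hd_excl u v x : u \notin star v -> hd v x != 0 -> hd u x = 0.
Proof.
move=> uv vx; have [y y0 ->] := hd_split v x; apply: hd_far => //.
by rewrite y0 addn0 modn_small ?hd_lt.
Qed.

Lemma hd_push u v k y : (0 < k < m v)%N -> hd v y = 0 ->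
  hd u (syl v k * y) = if u == v then k else if adj u v then hd u y else 0.
Proof.
move=> /andP [k0 km] y0; have [->|uv] := eqVneq u v.
  by rewrite hd_syl y0 addn0 modn_small.
case: ifP => [uv'|/negbT uv']; first exact: hd_syl_adj.
by apply: hd_syl_far => //; rewrite y0 addn0 modn_small // -lt0n.
Qed.

Lemma supp_syl v k x : supp (syl v k * x) \subset v |: supp x.
Proof.
have [y y0 E] := hd_split v x; set j := hd v x in E.
have yx : supp y \subset v |: supp x.
  have [j0|j0] := posnP j; first by rewrite E j0 syl0 mul1g subsetUr.
  rewrite E supp_push ?j0 ?hd_lt //.
  by rewrite setUA setUid subsetUr.
rewrite {1}E mulgA -sylD -syl_mod.
have [->|r0] := posnP ((k + j) %% m v).
  by rewrite syl0 mul1g; apply: yx.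
rewrite supp_push ?y0 ?r0 ?modn_lt //.
by rewrite subUset yx subsetUl.
Qed.

Lemma supp_syl1 v k : supp (syl v k) \subset [set v].
Proof. by have := supp_syl v k 1; rewrite mulg1 supp1 setU0. Qed.

Lemma suppM x y : supp (x * y) \subset supp x :|: supp y.
Proof.
elim/syl_ind: x => [|v k x km x0 IH]; first by rewrite mul1g subsetUr.
rewrite -mulgA supp_push // -setUA.
by apply: subset_trans (supp_syl _ _ _) _; apply: setUS.
Qed.

Lemma suppM_sub (A : {set 'I_N}) x y :
  supp x \subset A -> supp y \subset A -> supp (x * y) \subset A.
Proof.
by move=> xA yA; apply: subset_trans (suppM x y) _; rewrite subUset xA yA.
Qed.

Lemma suppV_sub (A : {set 'I_N}) x : supp x \subset A -> supp x^-1 \subset A.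
Proof.
elim/syl_ind: x => [|v k x km x0 IH]; first by rewrite invg1.
rewrite supp_push // subUset sub1set => /andP [vA xA].
rewrite invgM; apply: suppM_sub (IH xA) _; rewrite sylV; last by case/andP: km => _ /ltnW.
by apply: subset_trans (supp_syl1 _ _) _; rewrite sub1set.
Qed.

Lemma suppV x : supp x^-1 = supp x.
Proof.
apply/eqP; rewrite eqEsubset suppV_sub //=.
by have := @suppV_sub (supp x^-1) x^-1 (subxx _); rewrite invgK.
Qed.

Lemma suppX_sub (A : {set 'I_N}) x n : supp x \subset A -> supp (x ^+ n) \subset A.
Proof.
move=> xA; elim: n => [|n IH]; first by rewrite expg0 supp1 sub0set.
by rewrite expgS; apply: suppM_sub.
Qed.

Lemma len_syl v k x : (len (syl v k * x) <= (len x).+1)%N.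
Proof.
have [y y0 E] := hd_split v x; set j := hd v x in E.
have yx : (len y <= len x)%N.
  have [j0|j0] := posnP j; first by rewrite E j0 syl0 mul1g.
  by rewrite E len_push ?j0 ?hd_lt.
rewrite {1}E mulgA -sylD -syl_mod.
have [->|r0] := posnP ((k + j) %% m v); first by rewrite syl0 mul1g; lia.
by rewrite len_push ?y0 ?r0 ?modn_lt.
Qed.

Lemma lenM x y : (len (x * y) <= len x + len y)%N.
Proof.
elim/syl_ind: x => [|v k x km x0 IH]; first by rewrite mul1g len1.
by rewrite -mulgA (len_push km x0); apply: leq_trans (len_syl _ _ _) _.
Qed.

Lemma len_syl1 v k : (len (syl v k) <= 1)%N.
Proof. by have := len_syl v k 1; rewrite mulg1 len1. Qed.

Lemma lenV_le x : (len x^-1 <= len x)%N.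
Proof.
elim/syl_ind: x => [|v k x km x0 IH]; first by rewrite invg1.
rewrite (len_push km x0) invgM sylV; last by case/andP: km => _ /ltnW.
by apply: leq_trans (lenM _ _) _; rewrite -addn1 leq_add // len_syl1.
Qed.

Lemma lenV x : len x^-1 = len x.
Proof. by apply/eqP; rewrite eqn_leq lenV_le /= -{1}(invgK x) lenV_le. Qed.

Lemma len_strip v x : hd v x != 0 ->
  len x = (len (syl v (m v - hd v x) * x)).+1.
Proof.
move=> h0; have [y y0 E] := hd_split v x.
have hm := hd_lt v x.
have -> : syl v (m v - hd v x) * x = y.
  by rewrite {2}E mulgA -sylD subnK ?syl_order ?mul1g // ltnW.
by rewrite E len_push // hm lt0n h0.
Qed.

Lemma commute_syl v k x : supp x \subset star v -> commute (syl v k) x.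
Proof.
elim/syl_ind: x => [_|u j x km x0 IH]; first exact: commute1.
rewrite supp_push // subUset sub1set => /andP [uv xv].
apply: commuteM (IH xv); move: uv; rewrite in_star.
case/orP=> [/eqP ->|/(syl_comm j k)/commute_sym //].
exact/commuteX2/commute_refl.
Qed.

Lemma commute_supp x y : (forall u v, u \in supp x -> v \in supp y -> u \in star v) ->
  commute x y.
Proof.
elim/syl_ind: x => [_|u j x km x0 IH]; first exact/commute_sym/commute1.
rewrite supp_push // => H; apply/commute_sym/commuteM; apply/commute_sym.
  by apply: commute_syl; apply/subsetP => v vy; rewrite star_sym H // !inE eqxx.
by apply: IH => a v ax vy; apply: H => //; rewrite in_setU1 ax orbT.
Qed.

Lemma hd_notin v x : v \notin supp x -> hd v x = 0.
Proof. by move=> vx; apply/eqP; apply: contraNT vx => /hd_supp. Qed.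

(** The chambers [x] and [x * syl a l] share a panel of type [a]. The step between them changes the
    sector of (1, u) only if the panel lies on this wall. *)
Lemma hd_mulr u x a l : hd u (x * syl a l) =
  if (u == a) && (supp x \subset star a) then (hd a x + l) %% m a else hd u x.
Proof.
elim/syl_ind: x u => [|w k y km y0 IH] u.
  rewrite mul1g !hd1 supp1 sub0set andbT.
  have := hd_syl a l 1; rewrite mulg1 hd1 addn0 => hl.
  have [->|ua] := eqVneq u a; first by rewrite hl add0n.
  apply: hd_notin; apply/negP => /(subsetP (supp_syl1 _ _)).
  by rewrite inE (negPf ua).
have kk : k %% m w = k by case/andP: km => _ /modn_small.
have k0 : k != 0 by case/andP: km; rewrite lt0n.
rewrite -mulgA supp_push // subUset sub1set.
have [wa|wa] := eqVneq w a.
  subst w; rewrite star_refl /=.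
  have [->|ua] := eqVneq u a; rewrite /=.
    rewrite !hd_syl IH eqxx /= y0 addn0 kk add0n.
    by case: ifP => _; rewrite ?modnDmr ?addn0.
  have [ua'|ua'] := boolP (adj u a).
    by rewrite !hd_syl_adj // IH (negPf ua).
  have us : u \notin star a by rewrite in_star negb_or ua.
  rewrite [RHS]hd_far ?y0 ?addn0 ?kk //.
  have [r0|] := eqVneq ((k + hd a (y * syl a l)) %% m a) 0; last exact: hd_far.
  move: r0; rewrite IH eqxx /= y0; case: ifP => [ya|_]; last first.
    by rewrite addn0 kk => E; rewrite E in k0.
  rewrite add0n modnDmr => r0.
  rewrite -(commute_syl l ya) mulgA -sylD -syl_mod r0 syl0 mul1g.
  by apply: hd_notin; apply: contra us => /(subsetP ya).
have hw : hd w (y * syl a l) = 0 by rewrite IH (negPf wa).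
have [uw|uw] := eqVneq u w.
  by subst u; rewrite (negPf wa) /= !hd_syl hw y0.
have [uw'|uw'] := boolP (adj u w).
  rewrite [LHS]hd_syl_adj // IH [hd u (syl w k * y)]hd_syl_adj //.
  case: eqP => //= E; subst u.
  by rewrite star_sym in_star (negPf uw) uw' /= hd_syl_adj.
have us : u \notin star w by rewrite in_star negb_or uw.
rewrite [LHS]hd_far ?hw ?addn0 ?kk //.
have far : hd u (syl w k * y) = 0 by rewrite hd_far ?y0 ?addn0 ?kk.
by case: eqP => [E|_] //=; subst u; rewrite star_sym (negPf us) /= far.
Qed.

Lemma hd_mulr_neq u x a l : u != a -> hd u (x * syl a l) = hd u x.
Proof. by rewrite hd_mulr => /negPf ->. Qed.

Lemma syl_ind_r (P : W -> Prop) : P 1 ->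
  (forall v k y, (0 < k < m v)%N -> hd v y^-1 = 0 -> P y -> P (y * syl v k)) ->
  forall x, P x.
Proof.
move=> P1 PS x; rewrite -(invgK x); elim/syl_ind: x^-1 => [|v k y km y0 Py].
  by rewrite invg1.
rewrite invgM sylV; last by case/andP: km => _ /ltnW.
by apply: PS Py; rewrite ?invgK //; case/andP: km; lia.
Qed.

Lemma supp_hd v x : v \in supp x -> supp x \subset star v -> hd v x != 0.
Proof.
elim/syl_ind: x => [|u k x km x0 IH]; first by rewrite supp1 inE.
rewrite supp_push // in_setU1 subUset sub1set => vx /andP [uv xv].
move: uv vx; rewrite (hd_push _ km x0) star_sym in_star.
have [->|uv] := eqVneq v u; first by case/andP: km; rewrite lt0n.
by move=> /= -> xv'; apply: IH.
Qed.

(** Left multiplication by [gen v] always changes the sector of (1, v); right multiplication does so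
    only inside W_(star v). *)
Lemma centralizer_gen v x : commute x (gen v) -> supp x \subset star v.
Proof.
move=> xv; apply/negbNE/negP => nx.
have := congr1 (hd v) xv; rewrite -syl1 hd_mulr eqxx (negPf nx) /= hd_syl => E.
have := hd_lt v x; have := m_gt1 v => m1; move: E.
have [lt|ge] := leqP (1 + hd v x) (m v).-1; first by rewrite modn_small; lia.
move=> E hm; have E' : (1 + hd v x)%N = m v by lia.
by rewrite E' modnn in E; lia.
Qed.

Lemma hd_mull_star v x y : supp x \subset star v ->
  hd v (x * y) = (hd v x + hd v y) %% m v.
Proof.
elim/syl_ind: x => [|u k x km x0 IH].
  by rewrite mul1g hd1 add0n modn_small ?hd_lt.
rewrite supp_push // subUset sub1set => /andP [uv xv]; rewrite -mulgA.
move: uv; rewrite star_sym in_star; have [<-|uv] := eqVneq v u => /=.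
  by rewrite !hd_syl IH // modnDmr modnDml addnA.
by move=> vu; rewrite !hd_syl_adj // IH.
Qed.

Lemma hd_inv_star v x : supp x \subset star v -> (hd v x + hd v x^-1) %% m v = 0.
Proof. by move=> xv; rewrite -hd_mull_star // mulgV hd1. Qed.

(* The wall (x, v) is the set x W_(star v) of chambers; its sectors are the
   level sets of y |-> hd v (x^-1 * y). [crossing u v x] says that the walls
   (1, u) and (x, v) cross, or coincide when u = v. *)
Definition crossing u v x : Prop :=
  u \in star v /\ exists p q,
    [/\ x = p * q, supp p \subset star u & supp q \subset star v].

Lemma crossing_mulr u v x q : supp q \subset star v ->
  crossing u v (x * q) -> crossing u v x.
Proof.
move=> qv [uv [p [r [E pu rv]]]]; split=> //; exists p, (r * q^-1); split=> //.
  by rewrite mulgA -E mulgK.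
by apply: suppM_sub => //; apply: suppV_sub.
Qed.

Lemma hd_mulr_wall u v x q : ~ crossing u v x -> supp q \subset star v ->
  hd u (x * q) = hd u x.
Proof.
move=> nc; elim/syl_ind_r: q => [|a k q km q0 IH]; first by rewrite mulg1.
move=> qv.
have aq : a \in supp (q * syl a k).
  rewrite -suppV invgM sylV; last by case/andP: km; lia.
  by rewrite supp_push ?setU11 //; case/andP: km; lia.
have av := subsetP qv _ aq.
have qv' : supp q \subset star v.
  have -> : q = q * syl a k * syl a (m a - k).
    by rewrite -mulgA -sylD subnKC ?syl_order ?mulg1 //; case/andP: km; lia.
  apply: suppM_sub qv _; apply: subset_trans (supp_syl1 _ _) _.
  by rewrite sub1set.
rewrite mulgA hd_mulr IH //; case: andP => // -[/eqP E xqa]; subst a.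
exfalso; apply: nc; apply: (crossing_mulr qv'); split=> //.
by exists (x * q), 1; split; rewrite ?mulg1 ?supp1 ?sub0set.
Qed.

Lemma crossing_syl u v x k : crossing u v (syl u k * x) <-> crossing u v x.
Proof.
have aux j y : crossing u v y -> crossing u v (syl u j * y).
  case=> uv [p [q [-> pu qv]]]; split=> //; exists (syl u j * p), q; split=> //.
    by rewrite mulgA.
  apply: suppM_sub pu; apply: subset_trans (supp_syl1 _ _) _.
  by rewrite sub1set star_refl.
split; last exact: aux.
move/(aux (m u - k %% m u)%N); rewrite mulgA -(syl_mod u k) -sylD subnK.
  by rewrite syl_order mul1g.
exact/ltnW/modn_lt.
Qed.

(* If a wall does not cross the wall (1, u), then seen from it, everything
   which (1, u) separates from it lies in the direction of 1. *)
Lemma hd_nested u v g x : ~ crossing u v g -> hd u g <> hd u x ->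
  hd v (g^-1 * x) = hd v g^-1.
Proof.
(* A rotation around (1, u) brings [x] into the sector of 1. *)
wlog x0 : g x / hd u x = 0 => [gen_case|] nc hgx.
  pose k := (m u - hd u x)%N; have hm := hd_lt u x.
  have k_x : hd u (syl u k * x) = 0 by rewrite hd_syl subnK ?modnn // ltnW.
  have := gen_case (syl u k * g) (syl u k * x) k_x.
  rewrite invgM -mulgA mulKg => ->.
  - rewrite sylV ?leq_subr // hd_mulr; case: andP => // -[/eqP E gu]; subst v.
    exfalso; apply: nc; split; first exact: star_refl.
    exists g, 1; split; rewrite ?mulg1 ?supp1 ?sub0set //.
    by rewrite -suppV.
  - by move/crossing_syl.
  - rewrite k_x hd_syl => /eqP; rewrite -(modnn (m u)) -{2}(subnK (ltnW hm)).
    by rewrite -/k eqn_modDl !modn_small ?hd_lt // => /eqP.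
have g0 : hd u g != 0 by rewrite -x0; apply/eqP.
elim/syl_ind_r: x x0 {hgx} => [|a k x km xa IH x0]; first by rewrite mulg1.
have kk : k %% m a = k by case/andP: km => _ /modn_small.
have x0' : hd u x = 0.
  move: x0; rewrite hd_mulr; case: andP => // -[/eqP E xu]; subst a.
  have := hd_inv_star xu; rewrite xa addn0 modn_small ?hd_lt // => ->.
rewrite mulgA hd_mulr IH //; case: andP => // -[/eqP E gx]; subst a.
(* Here [x] is a chamber of the wall (g, v), which lies in the sector of [g], not in sector 0. *)
have := hd_mulr_wall nc gx; rewrite mulVKg x0' => E.
by rewrite -E eqxx in g0.
Qed.

Lemma hd_mulr_star v g y : ~~ (supp g \subset star v) -> supp y \subset star v ->
  hd v (g * y) = hd v g.
Proof.
move=> gv yv; apply: hd_mulr_wall yv => -[_ [p [q [E pv qv]]]].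
by case/negP: gv; rewrite E suppM_sub.
Qed.

Lemma crossing_same v g : crossing v v g -> supp g \subset star v.
Proof. by case=> _ [p [q [-> pv qv]]]; apply: suppM_sub. Qed.

Lemma hd_nested_same v g x : ~~ (supp g \subset star v) -> hd v g <> hd v x ->
  hd v (g^-1 * x) = hd v g^-1.
Proof. by move=> gv; apply: hd_nested => /crossing_same /(negP gv). Qed.

Lemma hd_mul_additive k x y : len (x * y) = (len x + len y)%N ->
  hd k (x * y) = if hd k x != 0 then hd k x
                 else if supp x \subset star k then hd k y else 0.
Proof.
elim/syl_ind: x => [|w l x lm x0 IH].
  by rewrite mul1g hd1 supp1 sub0set eqxx.
rewrite -mulgA (len_push lm x0) => E.
have l0 : l %% m w = l by case/andP: lm => _ /modn_small.
have Exy : len (x * y) = (len x + len y)%N.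
  have := len_syl w l (x * y); rewrite E addSn ltnS => le.
  by apply/eqP; rewrite eqn_leq lenM.
have h0 : hd w (x * y) = 0.
  apply/eqP; apply/negPn/negP => h0; have := len_strip h0.
  have := len_syl w (l + hd w (x * y)) (syl w (m w - hd w (x * y)) * (x * y)).
  rewrite mulgA -sylD -addnA subnKC; last exact/ltnW/hd_lt.
  by rewrite sylD syl_order mulg1 E addSn -Exy => le E2; rewrite -E2 ltnn in le.
rewrite (hd_push _ lm h0) (hd_push _ lm x0) supp_push // subUset sub1set.
have [->|kw] := eqVneq k w; first by case/andP: lm; rewrite lt0n => ->.
rewrite [w \in _]star_sym in_star (negPf kw) /=.
by case: ifP => kw' //=; apply: IH.
Qed.

End Walls.

(** * Thin triangles in the absence of induced squares *)

Section Thin.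
Implicit Types (u v k : 'I_N) (a b c x y z g p q : W) (A B : {set 'I_N}).

Definition clique A : Prop := forall u v, u \in A -> v \in A -> u \in star v.

Lemma clique_sub A B : A \subset B -> clique B -> clique A.
Proof. by move=> /subsetP AB cB u v /AB uB /AB vB; apply: cB. Qed.

Lemma clique_star A v : clique A -> v \in A -> A \subset star v.
Proof. by move=> cA vA; apply/subsetP => u uA; apply: cA. Qed.

Lemma clique_commute A x y : clique A -> supp x \subset A -> supp y \subset A ->
  commute x y.
Proof.
move=> cA /subsetP xA /subsetP yA; apply: commute_supp => u v ux vy.
by apply: cA; [apply: xA | apply: yA].
Qed.

Lemma len_clique x : clique (supp x) -> (len x <= #|supp x|)%N.
Proof.
elim/syl_ind: x => [|v k x km x0 IH]; first by rewrite len1.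
rewrite supp_push // len_push // => cl.
have xc : supp x \subset v |: supp x by apply: subsetUr.
have -> : #|v |: supp x| = #|supp x|.+1.
  rewrite cardsU1; case: (boolP (v \in supp x)) => // vx.
  have := supp_hd vx (clique_star (clique_sub xc cl) vx).
  by rewrite x0.
by rewrite ltnS; apply/IH/(clique_sub xc).
Qed.

Lemma len_clique_order x : clique (supp x) -> (len x <= N)%N.
Proof.
move/len_clique => le; apply: leq_trans le _.
by rewrite -[leqRHS](card_ord N); apply: max_card.
Qed.

Definition prefix p x : Prop := len x = (len p + len (p^-1 * x))%N.

Lemma prefix_hd p x k : prefix p x -> hd k p != 0 -> hd k x = hd k p.
Proof.
move=> px pk; rewrite -{1}(mulVKg p x) hd_mul_additive ?pk //.
by rewrite mulVKg.
Qed.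

Lemma prefix1 x : prefix 1 x.
Proof. by rewrite /prefix invg1 mul1g len1. Qed.

Lemma sylKV v (k : nat) x : (k <= m v)%N -> syl v k * (syl v (m v - k) * x) = x.
Proof. by move=> km; rewrite mulgA -sylD subnKC // syl_order mul1g. Qed.

Lemma sylVK v (k : nat) x : (k <= m v)%N -> syl v (m v - k) * (syl v k * x) = x.
Proof. by move=> km; rewrite mulgA -sylD subnK // syl_order mul1g. Qed.

(* Levi's lemma for trace monoids. *)
Lemma prefix_joined p q x : prefix p x -> prefix q x ->
  (forall k, hd k p = 0 \/ hd k q = 0) ->
  forall u v, u \in supp p -> v \in supp q -> adj u v.
Proof.
elim/syl_ind: p x => [|k s p sm p0 IH] x; first by rewrite supp1 => _ _ _ u v; rewrite inE.
move=> px qx disj u v; rewrite supp_push // in_setU1.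
have s0 : s != 0 by case/andP: sm; rewrite lt0n.
have sle : (s <= m k)%N by case/andP: sm => _ /ltnW.
have hkp : hd k (syl k s * p) = s by rewrite (hd_push _ sm p0) eqxx.
have hkx : hd k x = s by rewrite (prefix_hd px) hkp.
have hkq : hd k q = 0 by case: (disj k) => //; rewrite hkp => E; rewrite E in s0.
have qs : supp q \subset star k /\ hd k (q^-1 * x) = s.
  move: hkx; rewrite -{1}(mulVKg q x) hd_mul_additive ?mulVKg // hkq eqxx /=.
  by case: ifP => // _ E; rewrite -E in s0.
have kq : k \notin supp q by apply/negP => kq; have := supp_hd kq qs.1; rewrite hkq.
pose x' := syl k (m k - s) * x.
have lx : len x = (len x').+1 by have := len_strip (v := k) (x := x); rewrite hkx; apply.
have px' : prefix p x'.
  move: px; rewrite /prefix (len_push sm p0) lx addSn => -[->].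
  by rewrite invgM sylV // -mulgA.
have qx' : prefix q x'.
  rewrite /prefix /x' mulgA -(commute_syl (m k - s) (suppV_sub qs.1)) -mulgA.
  have := len_strip (x := q^-1 * x) (v := k); rewrite qs.2 => /(_ s0) E.
  by move: qx; rewrite /prefix lx E addnS => -[].
case/orP=> [/eqP -> vq|up vq]; last first.
  apply: (IH x' px' qx' _ u v up vq) => j; case: (disj j); last by right.
  have [->|jq] := eqVneq (hd j q) 0; first by right.
  have := subsetP qs.1 _ (hd_supp jq); rewrite in_star.
  case/orP=> [/eqP E|jk]; first by rewrite E hkq in jq.
  by rewrite hd_syl_adj // => ->; left.
have := subsetP qs.1 _ vq; rewrite star_sym in_star => /orP [/eqP E|//].
by rewrite E vq in kq.
Qed.

(** Common head syllables are stripped greedily. The third condition says that [p] lies on the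
    quasi-interval between [a] and [b]. *)
Lemma common_prefix a b : exists p, [/\ prefix p a, prefix p b &
  forall k, hd k (p^-1 * a) = hd k (p^-1 * b) -> hd k (p^-1 * a) = 0].
Proof.
have [n] := ubnP (len a); elim: n a b => // n IH a b; rewrite ltnS => an.
have [[k [E k0]]|nk] := pselect (exists k, hd k a = hd k b /\ hd k a != 0); last first.
  exists 1; split; [exact: prefix1 | exact: prefix1 | move=> k].
  rewrite invg1 !mul1g => E; apply/eqP/negPn/negP => k0.
  by apply: nk; exists k.
pose s := hd k a; have sm : (s <= m k)%N by apply/ltnW/hd_lt.
pose a' := syl k (m k - s) * a; pose b' := syl k (m k - s) * b.
have la : len a = (len a').+1 by apply: len_strip.
have lb : len b = (len b').+1 by rewrite /b' /s E; apply: len_strip; rewrite -E.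
have [|p [pa pb ex]] := IH a' b'; first by rewrite -la.
have lp : (len (syl k s * p) <= (len p).+1)%N by apply: len_syl.
have Ea : (syl k s * p)^-1 * a = p^-1 * a' by rewrite invgM sylV // -mulgA.
have Eb : (syl k s * p)^-1 * b = p^-1 * b' by rewrite invgM sylV // -mulgA.
have grow x x' : len x = (len x').+1 -> (syl k s * p)^-1 * x = p^-1 * x' ->
    prefix p x' -> prefix (syl k s * p) x.
  move=> lx Ex px; rewrite /prefix Ex; apply/eqP; rewrite eqn_leq; apply/andP; split.
    by rewrite -{1}(mulVKg (syl k s * p) x) Ex lenM.
  by rewrite lx px -addSn leq_add2r.
exists (syl k s * p); split; [exact: grow pa | exact: grow pb | by rewrite Ea Eb].
Qed.

(* The quasi-interval between [a] and [c]: no wall separates [x] from both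
   [a] and [c] in such a way that [a] and [c] lie in the same sector. *)
Definition hull a c x : Prop :=
  forall k, hd k (x^-1 * a) = hd k (x^-1 * c) -> hd k (x^-1 * a) = 0.

Lemma hullM g a c x : hull a c x -> hull (g * a) (g * c) (g * x).
Proof. by move=> H k; rewrite invgM -!mulgA !mulKg; apply: H. Qed.

Lemma hull_l a c : hull a c a.
Proof. by move=> k _; rewrite mulVg hd1. Qed.

Lemma hull_r a c : hull a c c.
Proof. by move=> k ->; rewrite mulVg hd1. Qed.

(** If [p^-1] and [q] had the same nonzero exponent at a head [k], cancelling these syllables would
    shorten [p * q]. *)
Lemma hull_geod a p q : len (p * q) = (len p + len q)%N -> hull a (a * (p * q)) (a * p).
Proof.
move=> lpq k; rewrite invgM -mulgA mulVg mulg1 -!mulgA !mulKg => E.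
apply/eqP/negPn/negP => k0; pose s := hd k p^-1.
have sm : (s <= m k)%N by apply/ltnW/hd_lt.
have lp := len_strip k0; have lq := len_strip (x := q) (v := k).
rewrite -E in lq; move/(_ k0): lq => lq; rewrite -/s in lp lq.
have : p * q = (syl k (m k - s) * p^-1)^-1 * (syl k (m k - s) * q).
  by rewrite invgM invgK -mulgA mulKg.
move/(congr1 len); rewrite lpq => E2.
have := lenM (syl k (m k - s) * p^-1)^-1 (syl k (m k - s) * q).
rewrite -E2 lenV lq -(lenV p) lp addSn addnS => lt.
by move: (leq_trans (leqnSn _) lt); rewrite ltnn.
Qed.

Lemma hull_connected a c (P : W -> Prop) : P a ->
  (forall p q, hull a c p -> hull a c q -> (len (p^-1 * q) <= 1)%N -> P p -> P q) ->
  P c.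
Proof.
move=> Pa step.
suff walk q p : len (p * q) = (len p + len q)%N -> a * (p * q) = c ->
    P (a * p) -> P c.
  apply: (walk (a^-1 * c) 1); first by rewrite mul1g len1.
    by rewrite mul1g mulVKg.
  by rewrite mulg1.
elim/syl_ind: q p => [|v k q km q0 IH] p; first by rewrite !mulg1 => _ ->.
rewrite (len_push km q0) => lpq pqc Pp.
have lp' : (len (p * syl v k) <= (len p).+1)%N.
  by apply: leq_trans (lenM _ _) _; rewrite -addn1 leq_add2l len_syl1.
have lpq' : len (p * syl v k * q) = (len (p * syl v k) + len q)%N.
  apply/eqP; rewrite eqn_leq lenM -mulgA lpq -addSnnS leq_add2r.
  by [].
apply: (IH (p * syl v k)) => //; first by rewrite -mulgA.
apply: (step (a * p)); last exact: Pp.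
- by rewrite -pqc; apply: hull_geod; rewrite lpq len_push.
- by rewrite -pqc (mulgA p); apply: hull_geod.
- by rewrite invgM -mulgA mulKg mulKg len_syl1.
Qed.

Hypothesis no_square : forall A B,
  (forall u v, u \in A -> v \in B -> adj u v) -> clique A \/ clique B.

(** With [x] moved to 1, a common head of the prefixes [p] and [q] would be a common head of [a] and
    [b] with equal exponents, against [hull a b 1]. So the supports of [p] and [q] are joined, one
    of them is a clique, and the corresponding prefix has at most [N] syllables. *)
Lemma hull_thin a b c x : hull a b x ->
  exists2 y, hull a c y \/ hull c b y & (len (x^-1 * y) <= N)%N.
Proof.
wlog -> : a b c x / x = 1 => [gen_case|] Hx.
  have [|y Hy ly] := gen_case (x^-1 * a) (x^-1 * b) (x^-1 * c) 1 erefl.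
    by rewrite -(mulVg x); apply: hullM.
  exists (x * y); last by move: ly; rewrite invg1 mul1g mulKg.
  by case: Hy => /(hullM (g := x)); rewrite !mulVKg; [left|right].
have [p [pa pc pm]] := common_prefix a c.
have [q [qc qb qm]] := common_prefix c b.
have joined : forall u v, u \in supp p -> v \in supp q -> adj u v.
  apply: (prefix_joined pc qc) => k.
  have [->|kp] := eqVneq (hd k p) 0; first by left.
  have [->|kq] := eqVneq (hd k q) 0; first by right.
  have := Hx k; rewrite invg1 !mul1g (prefix_hd pa kp) (prefix_hd qb kq).
  rewrite -(prefix_hd pc kp) -(prefix_hd qc kq) => /(_ erefl).
  by rewrite (prefix_hd pc kp) => E; rewrite E in kp.
case: (no_square joined) => cl.
  by exists p; [left | rewrite invg1 mul1g; apply: len_clique_order].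
by exists q; [right | rewrite invg1 mul1g; apply: len_clique_order].
Qed.

Lemma hull_syl a v l x : hull a (a * syl v l) x -> (len (a^-1 * x) <= 1)%N.
Proof.
move=> H; rewrite -lenV invgM invgK; set A := x^-1 * a.
have {}H k : hd k A = hd k (A * syl v l) -> hd k A = 0.
  by rewrite /A -mulgA; apply: H.
have neqv k : k != v -> hd k A = 0 by move=> kv; apply: H; rewrite hd_mulr_neq.
have [As|nAs] := boolP (supp A \subset star v); last first.
  have [->|/eqP/hd_ex [k kA]] := eqVneq A 1; first by rewrite len1.
  have [kv|/neqv E] := eqVneq k v; last by rewrite E in kA.
  by have := H v; rewrite hd_mulr eqxx (negPf nAs) /= -kv => /(_ erefl) E; rewrite E in kA.
have [y y0 E] := hd_split v A.
have yA : supp y \subset star v.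
  rewrite -(@sylVK v (hd v A) y); last exact/ltnW/hd_lt.
  rewrite -E; apply: suppM_sub As.
  by apply: subset_trans (supp_syl1 _ _) _; rewrite sub1set star_refl.
have [y1|/eqP/hd_ex [k ky]] := eqVneq y 1; first by rewrite E y1 mulg1 len_syl1.
have := subsetP yA _ (hd_supp ky); rewrite in_star.
case/orP=> [/eqP kv|kv]; first by rewrite kv y0 in ky.
by have := neqv k (edge_neq kv); rewrite E hd_syl_adj // => E'; rewrite E' in ky.
Qed.

Lemma hull_bounded n : exists C, forall a c x, (len (a^-1 * c) <= n)%N ->
  hull a c x -> (len (a^-1 * x) <= C)%N.
Proof.
(* The syllables of [a^-1 * c] are cut off one at a time: each thin triangle costs [N], each
   syllable one more. *)
exists (n * N.+1 + 1)%N => a c x.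
have -> : c = a * (a^-1 * c) by rewrite mulVKg.
rewrite mulKg; move: (a^-1 * c) => y {c}.
elim/syl_ind: y n a x => [|v k y km y0 IH] n a x ln Hx.
  have [E|/eqP/hd_ex [k kx]] := eqVneq (x^-1 * a) 1.
    by rewrite -lenV invgM invgK E len1.
  by have := Hx k; rewrite mulg1 => /(_ erefl) E; rewrite E in kx.
have [n' En] : exists n', n = n'.+1.
  by move: ln; rewrite len_push //; case: n => // n' _; exists n'.
subst n; rewrite len_push // ltnS in ln.
have [z [Hz|Hz] lz] := hull_thin (a * syl v k) Hx.
  have := hull_syl Hz => lz'.
  have -> : a^-1 * x = a^-1 * z * (x^-1 * z)^-1 by rewrite invgM invgK -mulgA mulVKg.
  apply: leq_trans (lenM _ _) _; rewrite lenV.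
  by apply: leq_trans (leq_add lz' lz) _; nia.
rewrite mulgA in Hz; have lz' := IH n' _ _ ln Hz.
have -> : a^-1 * x = syl v k * ((a * syl v k)^-1 * z) * (x^-1 * z)^-1.
  by rewrite [(x^-1 * z)^-1]invgM invgK invgM -!mulgA !mulVKg.
apply: leq_trans (lenM _ _) _; rewrite lenV.
apply: leq_trans (leq_add (len_syl _ _ _) lz) _.
by move: lz'; rewrite mulSn; set t := len _; lia.
Qed.

End Thin.

(** * Finiteness of the outer automorphism group in the absence of a SIL *)

Section FiniteOrder.
Implicit Types (u v k : 'I_N) (a b c x y z g p q t w : W) (A B : {set 'I_N}).

Lemma succ_modn_neq v n : (n < m v)%N -> ((1 + n) %% m v)%N <> n.
Proof.
have := label_gt1 v; set M := m v => M1 nM.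
have [lt|ge] := ltnP n.+1 M; first by rewrite add1n modn_small //; lia.
have -> : (1 + n)%N = M by lia.
by rewrite modnn; lia.
Qed.

Lemma modnD_inj v (r i j : nat) : (i < m v)%N -> (j < m v)%N ->
  ((r + i) %% m v = (r + j) %% m v)%N -> i = j.
Proof. by move=> im jm /eqP; rewrite eqn_modDl !modn_small // => /eqP. Qed.

Lemma torsion_gen v : torsion (gen v : W).
Proof. by exists (m v); [apply: label_gt0 | apply: syl_order]. Qed.

(** [t] maps every sector but that of [t^-1] into its own. If the two differed, all positive powers
    of [t], and so [t^-1], would stay in the sector of [t]. *)
Lemma torsion_hdV v t : torsion t -> ~~ (supp t \subset star v) ->
  hd v t^-1 = hd v t.
Proof.
case=> n n0 tn tv; apply: contrapT => neq.
have hX (k : nat) : hd v (t ^+ k.+1) = hd v t.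
  elim: k => [|k IH]; first by rewrite expg1.
  rewrite expgS -{1}(invgK t).
  by rewrite hd_nested_same ?invgK ?suppV // IH.
case: n n0 tn => [//|[|n]] _.
  by rewrite expg1 => t1; rewrite t1 supp1 sub0set in tv.
by rewrite expgS => /mulg1_eq E; apply: neq; rewrite E hX.
Qed.

(* Geometrically: [s] and [t] stabilize a common finite residue, and [hd v s] is
   the sector of the wall (1, v) in which the residues stabilized by [s] lie. *)
Lemma commuting_torsion_hd v s t : commute s t -> torsion s -> torsion t ->
  ~~ (supp s \subset star v) -> ~~ (supp t \subset star v) -> hd v s = hd v t.
Proof.
move=> st ts tt sv tv; apply: contrapT => neq.
have [stv|stv] := boolP (supp (s^-1 * t) \subset star v).
  by apply: neq; rewrite -(mulVKg s t) hd_mulr_star.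
(* If the sectors differ, [s^-1 * t] lies in the sector of [s] and its inverse in that of [t],
   against [torsion_hdV]. *)
have tst : torsion (s^-1 * t).
  by apply: torsionM (torsionV ts) tt; apply/commute_sym/commuteV/commute_sym.
have := torsion_hdV tst stv; rewrite invgM invgK.
rewrite !hd_nested_same // ?torsion_hdV //; last by move=> E; apply: neq.
by move=> E; apply: neq.
Qed.

(** If (1, u) separates the residues stabilized by [t] from the wall (w, v), then these residues are
    seen from (w, v) in the direction of 1. *)
Lemma torsion_nested u v w t : torsion t -> ~~ (supp t \subset star u) ->
  ~ crossing u v w -> hd u t <> hd u w ->
  ~~ (supp (w^-1 * t * w) \subset star v) /\ hd v (w^-1 * t * w) = hd v w^-1.
Proof.
move=> tt tu nc neq.
have tw : hd u (t * w) = hd u t.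
  by rewrite -{1}(invgK t) hd_nested_same ?invgK ?suppV // torsion_hdV.
split; last by rewrite -mulgA; apply: (hd_nested nc); rewrite tw; apply/nesym.
apply/negP => pv; apply: neq; rewrite -tw.
by rewrite -(hd_mulr_wall nc pv) !mulgA mulgV mul1g.
Qed.

Lemma len_syl_hd v r x : hd v x != 0 -> (len (syl v r * x) <= len x)%N.
Proof.
move=> h0; have [y y0 E] := hd_split v x.
have -> : len x = (len y).+1 by rewrite {1}E len_push // lt0n h0 hd_lt.
by rewrite E mulgA -sylD len_syl.
Qed.

(** By [torsion_hdV], [t] ends with the inverse of its first [v]-syllable. The conjugation merges
    with both ends, and cancels both when [s] is the exponent. *)
Lemma len_conj v (s : nat) t : (s <= m v)%N -> torsion t ->
  ~~ (supp t \subset star v) -> hd v t != 0 ->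
  (len ((syl v s)^-1 * t * syl v s) <= len t)%N /\
  (hd v t = s -> len t = (len ((syl v s)^-1 * t * syl v s)).+2).
Proof.
move=> sm tt tv h0.
have hV : hd v ((syl v s)^-1 * t)^-1 = hd v t.
  rewrite invgM invgK hd_mulr_star ?suppV ?torsion_hdV //.
  by apply: subset_trans (supp_syl1 _ _) _; rewrite sub1set star_refl.
have E : len ((syl v s)^-1 * t * syl v s) =
         len (syl v (m v - s) * ((syl v s)^-1 * t)^-1).
  by rewrite -lenV invgM sylV.
rewrite E; split.
  apply: leq_trans (len_syl_hd _ _) _; first by rewrite hV.
  by rewrite lenV sylV // len_syl_hd.
move=> hs; have h0' : hd v ((syl v s)^-1 * t)^-1 != 0 by rewrite hV.
have := len_strip h0'; rewrite hV hs lenV => <-.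
by rewrite sylV // -hs; apply: len_strip.
Qed.

Lemma clique_torsion A x : clique A -> supp x \subset A -> torsion x.
Proof.
move=> cA; elim/syl_ind: x => [_|v j x km x0 IH]; first by exists 1%N.
rewrite supp_push // subUset sub1set => /andP [vA xA].
apply: torsionM (IH xA).
  apply: (clique_commute cA) xA.
  by apply: subset_trans (supp_syl1 _ _) _; rewrite sub1set.
exists (m v); first exact: label_gt0.
by rewrite /syl -expgnA mulnC expgnA -/(syl v (m v)) syl_order expg1n.
Qed.

End FiniteOrder.

(** * Chains of walls that separate 1 from the residues of a torsion element *)

Section Chains.
Implicit Types (u v : 'I_N) (x y z g p q w : W).

Lemma conj_outside v w r x : supp r \subset star v ->
  ~~ (supp (w^-1 * x * w) \subset star v) ->
  ~~ (supp ((w * r)^-1 * x * (w * r)) \subset star v).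
Proof.
move=> rv; apply: contra => H.
have -> : w^-1 * x * w = r * ((w * r)^-1 * x * (w * r)) * r^-1.
  by rewrite invgM !mulgA mulgV mul1g mulgK.
by do 2?apply: suppM_sub => //; apply: suppV_sub.
Qed.

(* If no member were on the side of 1 of a wall adjacent to 1, conjugating across
   this wall would shorten the family; the case of an arbitrary wall follows
   by [torsion_nested]. *)
Lemma minimal_near (t : 'I_N -> W) : (forall i, torsion (t i)) ->
  (forall g, \sum_i len (t i) <= \sum_i len (g^-1 * t i * g))%N ->
  forall i v w, ~~ (supp (w^-1 * t i * w) \subset star v) ->
  hd v (w^-1 * t i * w) <> hd v w^-1 ->
  exists2 j, ~~ (supp (w^-1 * t j * w) \subset star v) &
             hd v (w^-1 * t j * w) = hd v w^-1.
Proof.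
move=> tt tmin.
have at1 i v : ~~ (supp (t i) \subset star v) -> hd v (t i) != 0 ->
    exists2 j, ~~ (supp (t j) \subset star v) & hd v (t j) = 0.
  move=> iv i0; apply: contrapT => nj.
  pose s := hd v (t i); have sm : (s <= m v)%N by apply/ltnW/hd_lt.
  have := tmin (syl v s); rewrite leqNgt => /negP; apply.
  rewrite [leqRHS](bigD1 i) //= (bigD1 i) //= -addSn.
  apply: leq_add.
    by have [_ ->] := len_conj sm (tt i) iv i0.
  apply: leq_sum => j _; have [jv|jv] := boolP (supp (t j) \subset star v).
    by rewrite -mulgA -(commute_syl _ jv) mulKg.
  have [j0|j0] := eqVneq (hd v (t j)) 0; first by case: nj; exists j.
  by have [] := len_conj sm (tt j) jv j0.
move=> i v w; have [n] := ubnP (len w); elim: n w => // n IH w; rewrite ltnS => wn.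
move=> iv ineq; have [w1|/eqP/hd_ex [u uw]] := eqVneq w 1.
  subst w; rewrite invg1 mul1g mulg1 hd1 in iv ineq *.
  have [|j jv j0] := at1 i v iv; first exact/eqP.
  by exists j; rewrite ?invg1 ?mul1g ?mulg1.
have [cr|nc] := pselect (crossing u v w).
  (* If the walls cross, [w * r = e * w] is a shorter representative of the wall (w, v); the change
     of representative shifts all sectors by the same amount. *)
  case: (cr) => uv [p [q [E pu qv]]].
  have lm : (hd u w <= m u)%N by apply/ltnW/hd_lt.
  pose e := syl u (m u - hd u w) : W; pose r := q^-1 * e * q.
  have rv : supp r \subset star v.
    do 2?apply: suppM_sub => //; first exact: suppV_sub.
    by apply: subset_trans (supp_syl1 _ _) _; rewrite sub1set.
  have Ew : w * r = e * w.
    by rewrite E /r !mulgA mulgK /e (commute_syl _ pu).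
  clearbody r.
  have shorter : (len (w * r) < n)%N.
    by apply: leq_trans wn; rewrite Ew (len_strip uw).
  have hdr x : hd v ((w * r)^-1 * x) = ((hd v r^-1 + hd v (w^-1 * x)) %% m v)%N.
    by rewrite invgM -mulgA hd_mull_star // suppV.
  have hdc j : ~~ (supp (w^-1 * t j * w) \subset star v) ->
      hd v ((w * r)^-1 * t j * (w * r)) =
      ((hd v r^-1 + hd v (w^-1 * t j * w)) %% m v)%N.
    by move=> jv; rewrite -mulgA hdr !mulgA (hd_mulr_star jv rv).
  have hd0 : hd v (w * r)^-1 = ((hd v r^-1 + hd v w^-1) %% m v)%N.
    by have := hdr 1; rewrite !mulg1.
  have [||j jv jE] := IH (w * r) shorter.
  - exact: conj_outside.
  - by rewrite hdc // hd0 => /(modnD_inj (hd_lt _ _) (hd_lt _ _)).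
  have jv' : ~~ (supp (w^-1 * t j * w) \subset star v).
    have := conj_outside (suppV_sub rv) jv.
    by rewrite -(mulgA w) mulgV mulg1.
  exists j => //; move: jE; rewrite hdc // hd0.
  by move/(modnD_inj (hd_lt _ _) (hd_lt _ _)).
have iu : ~~ (supp (t i) \subset star u) /\ hd u (t i) = hd u w.
  have [iu|iu] := boolP (supp (t i) \subset star u); last first.
    by split=> //; apply: contrapT => /(torsion_nested (tt i) iu nc) [_ /ineq].
  (* If [t i] stabilized (1, u), it would commute with the rotation [a], which (w, v) sees in the
     direction of 1; commuting torsion elements lie in one sector. *)
  exfalso; pose a := gen u : W.
  have aw : hd u (a * w) <> hd u w.
    by rewrite /a -syl1 hd_syl; apply: succ_modn_neq (hd_lt _ _).
  have ha : hd v (w^-1 * a * w) = hd v w^-1.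
    by rewrite -mulgA; apply: (hd_nested nc); apply/nesym.
  apply: ineq; rewrite -ha; apply: commuting_torsion_hd iv _.
  - apply: commute_conj; rewrite /a -syl1; exact/commute_sym/commute_syl.
  - exact: torsion_conj.
  - exact/torsion_conj/torsion_gen.
  - apply/negP => pv; apply: aw.
    by rewrite -[RHS](hd_mulr_wall nc pv) !mulgA mulgV mul1g.
(* A member in sector 0 of (1, u) is separated by this wall from (w, v), hence is seen from there on
   the side of 1. *)
have [|j ju j0] := at1 i u iu.1; first by rewrite iu.2.
exists j; have [] := @torsion_nested u v w (t j) (tt j) ju nc => //.
- by rewrite j0; apply/eqP; rewrite eq_sym.
- by rewrite j0; apply/eqP; rewrite eq_sym.
Qed.

Lemma hd_mull_adj u x y : (forall v, v \in supp x -> adj u v) ->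
  hd u (x * y) = hd u y.
Proof.
elim/syl_ind: x => [|v k x km x0 IH]; first by rewrite mul1g.
rewrite supp_push // => H; rewrite -mulgA hd_syl_adj ?H ?setU11 //.
by apply: IH => a ax; apply: H; rewrite in_setU1 ax orbT.
Qed.

Lemma extract_left (K : {set 'I_N}) x : exists a y,
  [/\ x = a * y, supp a \subset K, forall k, k \in K -> hd k y = 0,
      (len y <= len x)%N & (exists2 k, k \in K & hd k x != 0) -> (len y < len x)%N].
Proof.
have [n] := ubnP (len x); elim: n x => // n IH x; rewrite ltnS => xn.
have [[k kK hk]|no] := pselect (exists2 k, k \in K & hd k x != 0); last first.
  exists 1, x; split; rewrite ?mul1g ?supp1 ?sub0set // => k kK.
  by apply/eqP/negPn/negP => h; apply: no; exists k.
have lx := len_strip hk; set x' := _ * x in lx.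
have [|a [y [E aK yK ly _]]] := IH x'; first by rewrite -lx.
exists (syl k (hd k x) * a), y; split=> //; last by rewrite lx ltnS.
- by rewrite -mulgA -E sylKV // ltnW ?hd_lt.
- apply: suppM_sub aK; apply: subset_trans (supp_syl1 _ _) _.
  by rewrite sub1set.
- by rewrite lx (leq_trans ly).
Qed.

(* A sequence of conjugations each of which shortens [t] by two syllables; the
   k-th one corresponds to the k-th wall that separates 1 from the residues
   stabilized by [t]. *)
Fixpoint conj_chain t (s : seq ('I_N * nat)) : Prop :=
  if s is (v, l) :: s' then
    [/\ ~~ (supp t \subset star v), hd v t = l, l != 0 &
        conj_chain ((syl v l)^-1 * t * syl v l) s']
  else True.

Lemma evs_cat (s1 s2 : seq ('I_N * nat)) : evs (s1 ++ s2) = evs s1 * evs s2 :> W.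
Proof. by elim: s1 => [|a s IH] /=; rewrite ?mul1g // IH mulgA. Qed.

Lemma len_evs (s : seq ('I_N * nat)) : (len (evs s : W) <= size s)%N.
Proof.
elim: s => [|a s IH] /=; first by rewrite len1.
exact: leq_trans (len_syl _ _ _) _.
Qed.

Lemma conj_chain_cat t s1 s2 : conj_chain t (s1 ++ s2) ->
  conj_chain t s1 /\ conj_chain ((evs s1)^-1 * t * evs s1) s2.
Proof.
elim: s1 t => [|[v l] s IH] t /=; first by rewrite invg1 mul1g mulg1.
case=> tv hl l0 /IH [c1 c2]; split=> //.
by rewrite invgM -!mulgA; move: c2; rewrite -!mulgA.
Qed.

Lemma conj_chain_len t s : torsion t -> conj_chain t s ->
  len t = (2 * size s + len ((evs s)^-1 * t * evs s))%N.
Proof.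
elim: s t => [|[v l] s IH] t tt /=; first by rewrite invg1 mul1g mulg1.
case=> tv hl l0 c.
have lm : (l <= m v)%N by rewrite -hl; apply/ltnW/hd_lt.
have [|_ /(_ hl) ->] := len_conj lm tt tv; first by rewrite hl.
rewrite (IH _ (torsion_conj _ tt) c) invgM -!mulgA mulnS; set X := len _; lia.
Qed.

Lemma conj_chain_evs t s : torsion t -> conj_chain t s -> len (evs s : W) = size s.
Proof.
move=> tt c; apply/eqP; rewrite eqn_leq len_evs /=.
have := conj_chain_len tt c; set X := _ * _ * _.
have -> : t = evs s * X * (evs s)^-1 by rewrite /X !mulgA mulgV mul1g mulgK.
have := lenM (evs s * X) (evs s)^-1; have := lenM (evs s) X; rewrite lenV.
set a := len (_ * _^-1); set b := len (_ * X); set c1 := len (evs s); set d := len X.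
lia.
Qed.

(** When no conjugation shortens [t], each head of [t] commutes with the whole support. The heads
    form a clique that splits off, and the rest has no head left, so [t] has at most [N]
    syllables. *)
Lemma conj_chain_ex t : torsion t ->
  exists2 s, conj_chain t s & (len t <= 2 * size s + N)%N.
Proof.
have [n] := ubnP (len t); elim: n t => // n IH t; rewrite ltnS => tn tt.
have [[v [tv h0]]|no] := pselect (exists v, ~~ (supp t \subset star v) /\ hd v t != 0).
  have lm : (hd v t <= m v)%N by apply/ltnW/hd_lt.
  have [_ /(_ erefl) E] := len_conj lm tt tv h0.
  have [|s c ls] := IH _ _ (torsion_conj (syl v (hd v t)) tt).
    by apply: leq_trans tn; rewrite E.
  exists ((v, hd v t) :: s) => //=.
  by rewrite E mulnS; move: ls; set X := len _; lia.
exists [::] => //=; apply: len_clique_order.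
have star_hd v : hd v t != 0 -> supp t \subset star v.
  by move=> h0; apply/negPn/negP => tv; apply: no; exists v.
pose K := [set v | hd v t != 0].
have [a [x [tE aK xK _ _]]] := extract_left K t.
have cK : clique K.
  move=> u v; rewrite [u \in K]inE [v \in K]inE => /hd_supp ut /star_hd /subsetP sv.
  exact: sv.
suff x1 : x = 1 by rewrite tE x1 mulg1; apply: clique_sub aK cK.
apply: contrapT => /hd_ex [u ux].
have uK : u \notin K by apply/negP => /xK E; rewrite E in ux.
case/negP: (uK); rewrite inE tE hd_mull_adj // => v /(subsetP aK) vK.
have ut : u \in supp t.
  have : u \in supp (a^-1 * t) by rewrite tE mulKg; apply: hd_supp.
  apply/subsetP/suppM_sub => //; rewrite suppV; apply: subset_trans aK _.
  by apply/subsetP => k; rewrite inE => /hd_supp.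
have := subsetP (star_hd v _) _ ut; rewrite in_star => /(_ ltac:(by rewrite inE in vK)).
by case/orP=> // /eqP E; rewrite E vK in uK.
Qed.

End Chains.

(** * Ping-pong on the sectors of a wall *)

Section PingPong.
Variables (f : aut W) (v : 'I_N).
Implicit Types (u k : 'I_N) (x y z g p q w : W) (A B C : {set 'I_N}).

(** If [f a] stabilized (1, v), it would commute with the rotation [f h]. Then [h] commutes with
    [a], so its support avoids [B], and [h] commutes with a generator [k] of W_A; but [f (gen k)]
    does not commute with [gen v]. *)
Lemma clique_image_sector A B C (p : nat) (h : W) : clique (A :|: C) ->
  (forall a b, a \in A -> b \in B -> a \notin star b) ->
  supp h \subset A :|: B :|: C -> f h = gen v ->
  (forall k, k \in A -> ~~ (supp (f (gen k)) \subset star v) /\ hd v (f (gen k)) = p) ->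
  forall a, supp a \subset A -> a <> 1 ->
  ~~ (supp (f a) \subset star v) /\ hd v (f a) = p.
Proof.
move=> cA AB hE fh fA a aA a1.
have [k ka] := hd_ex a1; have kA := subsetP aA _ (hd_supp ka).
have cAA : clique A by apply: clique_sub cA; apply: subsetUl.
have [nk pk] := fA k kA.
have genA : supp (gen k) \subset A.
  by rewrite -syl1; apply: subset_trans (supp_syl1 _ _) _; rewrite sub1set.
have out : ~~ (supp (f a) \subset star v).
  apply/negP => fav.
  have ah : commute a h.
    apply/(aut_commute f); rewrite fh -syl1; exact/commute_sym/commute_syl.
  have ak : supp a \subset star k.
    by apply: subset_trans aA _; apply: clique_star.
  have hk : supp h \subset star k.
    apply/negPn/negP => nh; have := congr1 (hd k) ah.
    rewrite (hd_mull_star _ ak) (hd_mulr_star nh ak) => E.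
    have := @modnD_inj k (hd k h) (hd k a) 0 (hd_lt _ _) (label_gt0 _).
    by rewrite addn0 addnC E modn_small ?hd_lt // => /(_ erefl) E0; rewrite E0 in ka.
  have hAC : supp h \subset A :|: C.
    apply/subsetP => u uh; have := subsetP hE _ uh; have := subsetP hk _ uh.
    rewrite !in_setU => uk /orP [/orP [->//|uB]|->]; rewrite ?orbT //.
    by have := AB _ _ kA uB; rewrite star_sym uk.
  case/negP: nk; apply: centralizer_gen; rewrite -fh; apply/aut_commute.
  by apply: (clique_commute cA) hAC; apply: subset_trans genA (subsetUl _ _).
split=> //; rewrite -pk; apply: commuting_torsion_hd => //.
- by apply/aut_commute/(clique_commute cAA).
- exact/torsion_aut/(clique_torsion cAA).
- exact/torsion_aut/torsion_gen.
Qed.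

Variables (A B C : {set 'I_N}) (p l : nat) (h : W).
Hypothesis cAC : clique (A :|: C).
Hypothesis cBC : clique (B :|: C).
Hypothesis AB : forall a b, a \in A -> b \in B -> a \notin star b.
Hypothesis hE : supp h \subset A :|: B :|: C.
Hypothesis fh : f h = gen v.
Hypothesis fA : forall k, k \in A ->
  ~~ (supp (f (gen k)) \subset star v) /\ hd v (f (gen k)) = p.
Hypothesis fB : forall k, k \in B ->
  ~~ (supp (f (gen k)) \subset star v) /\ hd v (f (gen k)) = l.
Hypothesis fC : forall k, k \in C -> supp (f (gen k)) \subset star v.
Hypothesis pl : p <> l.

Let outA a : supp a \subset A -> a <> 1 ->
  ~~ (supp (f a) \subset star v) /\ hd v (f a) = p.
Proof. exact: (clique_image_sector cAC AB hE fh fA). Qed.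

Let outB b : supp b \subset B -> b <> 1 ->
  ~~ (supp (f b) \subset star v) /\ hd v (f b) = l.
Proof.
have hE' : supp h \subset B :|: A :|: C by rewrite (setUC B A).
apply: (clique_image_sector cBC _ hE' fh fB).
by move=> b' a bB aA; rewrite star_sym AB.
Qed.

(* The images of the nontrivial elements of W_A map every sector of the wall
   (1, v) but the p-th one into the p-th one, those of W_B every sector but
   the l-th one into the l-th one. *)
Lemma ping_pong x y : supp x \subset A :|: B -> supp y \subset star v ->
  ((exists2 k, k \in A & hd k x != 0) -> hd v (f x * y) = p) /\
  ((exists2 k, k \in B & hd k x != 0) -> hd v (f x * y) = l).
Proof.
have [n] := ubnP (len x); elim: n x => // n IH x; rewrite ltnS => xn xAB yv.
have step (A' B' : {set 'I_N}) (p' l' : nat) : A' :|: B' = A :|: B ->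
    (forall a, supp a \subset A' -> a <> 1 ->
      ~~ (supp (f a) \subset star v) /\ hd v (f a) = p') ->
    p' <> l' ->
    (forall x', (len x' < len x)%N -> supp x' \subset A :|: B ->
      (exists2 k, k \in B' & hd k x' != 0) -> hd v (f x' * y) = l') ->
    (exists2 k, k \in A' & hd k x != 0) -> hd v (f x * y) = p'.
  move=> AB' out pl' IH' hx.
  have [a [x1 [E aA x1A _ /(_ hx) lx1]]] := extract_left A' x.
  have a1 : a <> 1 by move=> a1; rewrite E a1 mul1g ltnn in lx1.
  have [fa fap] := out a aA a1.
  rewrite E autM -mulgA.
  have [->|/eqP x1n] := eqVneq x1 1.
    by rewrite aut1 mul1g hd_mulr_star.
  have x1AB : supp x1 \subset A :|: B.
    rewrite -(mulKg a x1) -E; apply: suppM_sub => //; rewrite suppV -AB'.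
    exact: subset_trans aA (subsetUl _ _).
  have [k kx1] := hd_ex x1n.
  have kB : k \in B'.
    have := subsetP x1AB _ (hd_supp kx1); rewrite -AB' in_setU.
    by case/orP=> // /x1A E0; rewrite E0 in kx1.
  have y1 := IH' x1 lx1 x1AB (ex_intro2 _ _ k kB kx1).
  have tA : hd v (f a)^-1 = p' by rewrite -autV; apply: (out _ _ _).2;
    rewrite ?suppV // => /(congr1 (fun x => x^-1)); rewrite invgK invg1.
  rewrite -{1}(invgK (f a)) hd_nested_same ?invgK ?suppV //.
  by rewrite tA y1.
split; [apply: (step A B p l) | apply: (step B A l p)] => //.
- by move=> x' lx' x'AB; apply: (IH x' _ x'AB yv).2; apply: leq_trans xn.
- by rewrite setUC.
- exact/nesym.
- by move=> x' lx' x'AB; apply: (IH x' _ x'AB yv).1; apply: leq_trans xn.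
Qed.

Lemma split_central x : supp x \subset A :|: B :|: C -> exists h0 c,
  [/\ x = h0 * c, supp h0 \subset A :|: B & supp c \subset C].
Proof.
elim/syl_ind: x => [_|k j x km x0 IH].
  by exists 1, 1; rewrite mulg1 supp1 !sub0set.
rewrite supp_push // subUset sub1set => /andP [kE /IH [h0 [c [-> hAB cC]]]].
move: kE; rewrite in_setU => /orP [kAB|kC].
  exists (syl k j * h0), c; split; rewrite ?mulgA //; apply: suppM_sub hAB.
  by apply: subset_trans (supp_syl1 _ _) _; rewrite sub1set.
exists h0, (syl k j * c); split=> //; last first.
  apply: suppM_sub cC; apply: subset_trans (supp_syl1 _ _) _.
  by rewrite sub1set.
rewrite !mulgA; congr (_ * _); apply: commute_syl.
apply: subset_trans hAB _; apply/subsetP => u; rewrite in_setU => uAB.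
case/orP: uAB => [uA|uB].
  by apply: cAC; rewrite in_setU ?uA ?kC ?orbT.
by apply: cBC; rewrite in_setU ?uB ?kC ?orbT.
Qed.

(** Write [h = h0 * c] with [c] in W_C. As [f h0] stabilizes (1, v), it shifts the sectors within
    W_(star v), while ping-pong sends all of W_(star v) into one sector if [h0] is nontrivial. If
    [h0 = 1], then [h] commutes with W_A, a contradiction too. *)
Lemma ping_pong_false k : k \in A -> False.
Proof.
move=> kA; have [h0 [c [E h0AB cC]]] := split_central hE.
have fc : supp (f c) \subset star v.
  elim/syl_ind: c cC {E} => [_|u j x km x0 IH]; first by rewrite aut1 supp1 sub0set.
  rewrite supp_push // subUset sub1set => /andP [uC xC].
  rewrite autM autX; apply: suppM_sub (IH xC).
  exact/suppX_sub/fC.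
have fh0 : supp (f h0) \subset star v.
  have -> : f h0 = gen v * (f c)^-1 by rewrite -fh E autM mulgK.
  apply: suppM_sub (suppV_sub fc); rewrite -syl1.
  by apply: subset_trans (supp_syl1 _ _) _; rewrite sub1set star_refl.
have [h01|/eqP h01] := eqVneq h0 1.
  case/negP: (fA kA).1; apply: centralizer_gen; rewrite -fh E h01 mul1g.
  apply/aut_commute; apply: (clique_commute cAC).
    rewrite -syl1; apply: subset_trans (supp_syl1 _ _) _.
    by rewrite sub1set in_setU kA.
  exact: subset_trans cC (subsetUr _ _).
have const y : supp y \subset star v -> hd v (f h0 * y) = hd v (f h0).
  move=> yv; have [u uh] := hd_ex h01.
  have [HA HB] := ping_pong h0AB yv.
  have [] := @ping_pong h0 1 h0AB; first by rewrite supp1 sub0set.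
  rewrite mulg1 => HA1 HB1.
  have := subsetP h0AB _ (hd_supp uh); rewrite in_setU => /orP [uA|uB].
    by rewrite HA ?HA1 //; exists u.
  by rewrite HB ?HB1 //; exists u.
have gv : supp (gen v) \subset star v.
  rewrite -syl1; apply: subset_trans (supp_syl1 _ _) _.
  by rewrite sub1set star_refl.
have hg : hd v (gen v) = (1 %% m v)%N.
  by rewrite -syl1 -(mulg1 (syl v 1)) hd_syl hd1.
have := const _ gv; rewrite hd_mull_star // hg modnDmr addnC.
exact: succ_modn_neq (hd_lt _ _).
Qed.

End PingPong.

(** * Two walls that separate in the same way *)

Section Rigidity.
Implicit Types (u v k : 'I_N) (x y z g w : W) (A B C : {set 'I_N}).

Lemma dist_geq2 u v : u \notin star v -> dist_geq adj u v 2.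
Proof.
move=> /notin_star [uv nuv] [|a [|b p]] //=.
  by move=> _ E; rewrite E eqxx in uv.
by rewrite andbT => ua E; rewrite E in ua; rewrite ua in nuv.
Qed.

(** [C] lies in the common link of [x1] and [x2]. If the component of [k] outside this link missed
    both vertices, it would exhibit a SIL. *)
Lemma no_SIL_components C (x1 x2 k : 'I_N) : ~ has_SIL adj -> x1 \notin star x2 ->
  x1 \notin C -> x2 \notin C -> C \subset star x1 -> C \subset star x2 -> k \notin C ->
  connect (full_subgraph adj (~: C)) k x1 \/ connect (full_subgraph adj (~: C)) k x2.
Proof.
move=> noSIL x12 x1C x2C C1 C2 kC; apply: contrapT => nc.
have [nc1 nc2] : ~~ connect (full_subgraph adj (~: C)) k x1 /\
                 ~~ connect (full_subgraph adj (~: C)) k x2.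
  by split; apply/negP => c; apply: nc; [left|right].
pose D := ~: (link adj x1 :&: link adj x2).
have CD c : c \in C -> c \in link adj x1 :&: link adj x2.
  move=> cC; rewrite in_setI !inE.
  have := subsetP C1 _ cC; have := subsetP C2 _ cC; rewrite !in_star.
  case: eqP => [E|_ /= c2]; first by rewrite -E cC in x2C.
  case: eqP => [E|_ /= c1]; first by rewrite -E cC in x1C.
  by rewrite edge_sym c1 edge_sym c2.
have kD : k \in D.
  rewrite !inE; apply: contra nc1 => /andP [k1 _]; apply: connect1.
  by apply/and3P; rewrite !in_setC; split=> //; rewrite edge_sym.
have sub a b : connect (full_subgraph adj D) a b -> connect (full_subgraph adj (~: C)) a b.
  apply: connect_sub => a' b' /and3P [aD bD ab]; apply: connect1.
  apply/and3P; rewrite !in_setC; split=> //.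
    by apply/negP => /CD E; rewrite in_setC E in aD.
  by apply/negP => /CD E; rewrite in_setC E in bD.
pose R := [set y | connect (full_subgraph adj D) k y].
have R1 : x1 \notin R by rewrite inE; apply: contra nc1 => /sub.
have R2 : x2 \notin R by rewrite inE; apply: contra nc2 => /sub.
have compR : is_component adj D R by exists k.
have [ne _] := notin_star x12.
apply: noSIL; have [lt|ge] := ltnP x1 x2.
  by exists x1, x2; split=> //; [exact: dist_geq2 | exists R].
exists x2, x1; split.
- by rewrite ltn_neqAle ge andbT eq_sym.
- by apply: dist_geq2; rewrite star_sym.
- by exists R; rewrite setIC.
Qed.

(* The wall (1, v) separates f(i) from f(j), and every f(c) that stabilizes it
   stabilizes the wall (y, v) as well. The preimages under f of the rotations
   around these two walls do not commute, but are supported on vertices that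
   commute with all these c, which yields the two non-adjacent vertices
   required by [no_SIL_components]. *)
Lemma rigid (f : aut W) v y (l : nat) i j : ~ has_SIL adj ->
  ~~ (supp y \subset star v) ->
  (forall c, supp (f (gen c)) \subset star v ->
             supp (y^-1 * f (gen c) * y) \subset star v) ->
  ~~ (supp (f (gen i)) \subset star v) -> hd v (f (gen i)) = l ->
  ~~ (supp (f (gen j)) \subset star v) -> hd v (f (gen j)) <> l -> False.
Proof.
move=> noSIL yv cross iv il jv jl.
pose C := [set c | supp (f (gen c)) \subset star v].
pose H k := hd v (f (gen k)).
have inC k : (k \in C) = (supp (f (gen k)) \subset star v) by rewrite inE.
(* Adjacent vertices outside [C] have commuting images, so [H] is constant on the components of the
   complement of [C]. *)
have Hadj a b : a \notin C -> b \notin C -> adj a b -> H a = H b.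
  rewrite !inC => aC bC ab; apply: commuting_torsion_hd => //.
  - exact/aut_commute/gen_comm.
  - exact/torsion_aut/torsion_gen.
  - exact/torsion_aut/torsion_gen.
have Hconn a b : connect (full_subgraph adj (~: C)) a b -> H a = H b.
  case/connectP=> s; elim: s a => [a _ -> //|c s IH a /=].
  case/andP=> /and3P [aC cC ac] /IH{}IH /IH <-.
  by rewrite !in_setC in aC cC; apply: Hadj.
pose z : W := gen v; pose z' : W := y * z * y^-1.
have [h fh] : exists h, f h = z by exists (aut_inv_fun f z); apply: aut_inv_funK.
have [h' fh'] : exists h, f h = z' by exists (aut_inv_fun f z'); apply: aut_inv_funK.
pose E := [set k | [forall c in C, k \in star c]].
have inE' k : k \in E -> forall c, c \in C -> k \in star c.
  by rewrite inE => /forall_inP.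
have suppE x : (forall c, c \in C -> commute (f x) (f (gen c))) -> supp x \subset E.
  move=> comm; apply/subsetP => k kx; rewrite inE; apply/forall_inP => c cC.
  have := comm c cC => /aut_commute /centralizer_gen /subsetP; exact.
have hE : supp h \subset E.
  apply: suppE => c; rewrite inC fh /z -(syl1 v); exact: commute_syl.
have h'E : supp h' \subset E.
  apply: suppE => c; rewrite inC fh' => /cross cv.
  have := commute_conj y^-1 (commute_syl 1 cv); rewrite syl1 invgK.
  by rewrite !mulgA mulgV mul1g mulgK.
have nzz : ~ commute z' z.
  move=> /centralizer_gen z'v.
  have := hd_mulr_star (g := y^-1); rewrite suppV => /(_ v z' yv z'v).
  rewrite /z' !mulgA mulVg mul1g /z -syl1 hd_syl.
  exact: succ_modn_neq (hd_lt _ _).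
have [x1 [x2 [x1E x2E x12]]] : exists x1 x2 : 'I_N, [/\ x1 \in E, x2 \in E & x1 \notin star x2].
  apply: contrapT => no; apply: nzz; rewrite -fh -fh'; apply/aut_commute.
  apply: commute_supp => a b /(subsetP h'E) aE /(subsetP hE) bE.
  by apply/negPn/negP => ab; apply: no; exists a, b.
have notC a b : a \in E -> b \in E -> a \notin star b -> a \notin C.
  by move=> aE bE; apply: contra => aC; rewrite star_sym; apply: inE'.
have subC a : a \in E -> C \subset star a.
  by move=> aE; apply/subsetP => c cC; rewrite star_sym; apply: inE'.
have comps a b k : a \in E -> b \in E -> a \notin star b -> k \notin C ->
    H k = H a \/ H k = H b.
  move=> aE bE ab kC; have ba : b \notin star a by rewrite star_sym.
  have [/Hconn ->|/Hconn ->] := no_SIL_components noSIL ab (notC _ _ aE bE ab)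
    (notC _ _ bE aE ba) (subC _ aE) (subC _ bE) kC; by [left|right].
have iC : i \notin C by rewrite inC.
have jC : j \notin C by rewrite inC.
pose p := H j.
(* Every vertex outside [C] has the value of [a] or of [b], and [i], [j] show that two values occur.
   So non-adjacent vertices of [E] have different values, and the two classes [A] and [B] are
   cliques. *)
have two a b : a \in E -> b \in E -> a \notin star b ->
    (H a = l /\ H b = p) \/ (H a = p /\ H b = l).
  move=> aE bE ab.
  have [Ei|Ei] := comps a b i aE bE ab iC; have [Ej|Ej] := comps a b j aE bE ab jC.
  - by case: jl; rewrite -/(H j) Ej -Ei.
  - by left; rewrite -Ei /p Ej.
  - by right; rewrite -Ei /p Ej.
  - by case: jl; rewrite -/(H j) Ej -Ei.
pose A := [set k in E | (k \notin C) && (H k == p)].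
pose B := [set k in E | (k \notin C) && (H k == l)].
pose C0 := E :&: C.
have pl : p <> l by [].
have cl (q q' : nat) (D : {set 'I_N}) : D = [set k in E | (k \notin C) && (H k == q)] ->
    (q = p /\ q' = l) \/ (q = l /\ q' = p) -> clique (D :|: C0).
  move=> -> qq a b aD bD; apply/negPn/negP => ab.
  have aE : a \in E by move: aD; rewrite !inE => /orP [/andP []|/andP []].
  have bE : b \in E by move: bD; rewrite !inE => /orP [/andP []|/andP []].
  have aC := notC _ _ aE bE ab; have bC := notC b a bE aE; rewrite star_sym in bC.
  have {}bC := bC ab.
  have Ha : H a = q.
    by move: aD; rewrite in_setU in_setI (negPf aC) andbF orbF inE => /and3P [_ _ /eqP].
  have Hb : H b = q.
    by move: bD; rewrite in_setU in_setI (negPf bC) andbF orbF inE => /and3P [_ _ /eqP].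
  by have := two a b aE bE ab; rewrite Ha Hb; case=> -[E1 E2]; apply: pl; rewrite -?E1 -?E2.
have cAC : clique (A :|: C0) by apply: (cl p l) => //; left.
have cBC : clique (B :|: C0) by apply: (cl l p) => //; right.
have AB a b : a \in A -> b \in B -> a \notin star b.
  rewrite !inE => /and3P [_ aC /eqP Ha] /and3P [_ bC /eqP Hb].
  apply/negP => /orP [/eqP ab|ab]; first by apply: pl; rewrite -Ha -Hb ab.
  by apply: pl; rewrite -Ha -Hb; apply: Hadj ab; rewrite inC.
have [x3 x3A] : exists k, k \in A.
  have := two _ _ x1E x2E x12; have x21 : x2 \notin star x1 by rewrite star_sym.
  case=> -[H1 H2]; [exists x2 | exists x1]; rewrite inE; apply/and3P; split=> //.
  - exact: notC x21.
  - exact/eqP.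
  - exact: notC x12.
  - exact/eqP.
have hABC : supp h \subset A :|: B :|: C0.
  apply/subsetP => k kh; have kE := subsetP hE _ kh.
  rewrite !in_setU in_setI kE /=; have [kC|kC] := boolP (k \in C); first by rewrite orbT.
  rewrite orbF ![k \in [set _ in _ | _]]inE kE kC /=.
  have := comps _ _ k x1E x2E x12 kC; have := two _ _ x1E x2E x12.
  by case=> -[-> ->] [->|->]; rewrite eqxx ?orbT.
apply: (@ping_pong_false f v A B C0 p l h cAC cBC AB hABC fh _ _ _ pl x3 x3A).
- by move=> k; rewrite inE => /and3P [_ kC /eqP]; rewrite -inC.
- by move=> k; rewrite inE => /and3P [_ kC /eqP]; rewrite -inC.
- by move=> k; rewrite in_setI inC => /andP [].
Qed.

End Rigidity.

(** * Bounding the automorphisms that are minimal under conjugation *)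

Section FiniteOut.
Implicit Types (u v : 'I_N) (t x y z g w : W) (s : seq ('I_N * nat)).

(** Otherwise a shorter representative [q^-1] of the wall would conjugate [t] to an element no
    longer than [X], and [t] would be shorter than [conj_chain_len] allows. *)
Lemma conj_chain_hd0 t s1 v l s2 : torsion t -> conj_chain t (s1 ++ (v, l) :: s2) ->
  hd v (evs s1 : W)^-1 = 0.
Proof.
move=> tt /conj_chain_cat [c1 /= [xv xl l0 _]].
have := conj_chain_len tt c1; have := conj_chain_evs tt c1.
set w := evs s1 in xv xl *; set X := _^-1 * t * w in xv xl *.
move=> sw lt; apply/eqP/negPn/negP => r0; pose r := hd v w^-1.
have rm : (r <= m v)%N by apply/ltnW/hd_lt.
have tX : torsion X by apply: torsion_conj.
have l0' : hd v X != 0 by rewrite xl.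
have [lX _] := len_conj rm tX xv l0'.
have := len_strip r0; rewrite -/r lenV -sylV //; set q := _ * w^-1 => lw.
set Y := _ * X * _ in lX.
have E : t = q^-1 * (Y * q).
  by rewrite /q /Y /X invgM !invgK !mulgA !mulgK mulgV mul1g.
have := lenM q^-1 (Y * q); rewrite -E lenV.
have := lenM Y q; move: lX lw lt; rewrite sw.
set a := len X; set b := len Y; set c := len q; set e := len (Y * q).
lia.
Qed.

Lemma conj_chain_first t v l s : torsion t -> conj_chain t ((v, l) :: s) ->
  hd v (evs ((v, l) :: s) : W) = l.
Proof.
move=> tt c; have := conj_chain_evs tt c; case: c => _ hl l0 _ /=.
have lm : (l < m v)%N by rewrite -hl hd_lt.
set y := evs s => ly.
have [y0|y0] := eqVneq (hd v y) 0; first by rewrite hd_syl y0 addn0 modn_small.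
have := len_syl_hd l y0; rewrite ly ltnNge /=.
by rewrite len_evs.
Qed.

(** Two syllables for each separating wall, at most [2 * N + 1] walls for each of the [N] types, and
    [N] for the clique element at the end of the chain. *)
Definition diameter_bound : nat := 2 * (N * (2 * N).+1) + N.

Lemma minimal_bounded (f : aut W) : ~ has_SIL adj ->
  (forall g, \sum_i len (f (gen i)) <= \sum_i len (g^-1 * f (gen i) * g))%N ->
  forall i, (len (f (gen i)) <= diameter_bound)%N.
Proof.
move=> noSIL fmin i; pose t j : W := f (gen j).
have tt j : torsion (t j) by apply/torsion_aut/torsion_gen.
have [s c ls] := conj_chain_ex (tt i).
suff ss : (size s <= N * (2 * N).+1)%N.
  by apply: leq_trans ls _; rewrite leq_add2r leq_mul2l ss.
pose w n : W := evs (take n s).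
pose vn n := (nth (i, 0) s n).1; pose ln n := (nth (i, 0) s n).2.
pose X n j : W := (w n)^-1 * t j * w n.
have tX n j : torsion (X n j) by apply: torsion_conj.
have dropE n : (n < size s)%N -> drop n s = (vn n, ln n) :: drop n.+1 s.
  by move=> ns; rewrite (drop_nth (i, 0) ns) /vn /ln; case: (nth _ s n).
have chainX n : conj_chain (X n i) (drop n s).
  by move: c; rewrite -{1}(cat_take_drop n s) => /conj_chain_cat [].
have Xi n : (n < size s)%N ->
    [/\ ~~ (supp (X n i) \subset star (vn n)), hd (vn n) (X n i) = ln n & ln n != 0].
  by move=> ns; have := chainX n; rewrite dropE //= => -[].
have w0 n : (n < size s)%N -> hd (vn n) (w n)^-1 = 0.
  move=> ns; apply: (conj_chain_hd0 (l := ln n) (s2 := drop n.+1 s) (tt i)).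
  by rewrite -dropE // cat_take_drop.
(* [Far n] collects the images in the same sector of the n-th wall as [f (gen i)], [Near n] those in
   any other sector, not only in that of 1. *)
pose Out n j := ~~ (supp (X n j) \subset star (vn n)).
pose Far n := [set j | Out n j && (hd (vn n) (X n j) == ln n)].
pose Near n := [set j | Out n j && (hd (vn n) (X n j) != ln n)].
have nested n n' : (n < n' < size s)%N -> vn n = vn n' ->
    [/\ Near n \subset Near n', Far n' \subset Far n &
         ~ (Near n = Near n' /\ Far n = Far n')].
  case/andP=> nn' ns' Ev; have ns : (n < size s)%N by apply: ltn_trans ns'.
  pose k := (n' - n)%N; pose y : W := evs (take k (drop n s)).
  have wE : w n' = w n * y.
    by rewrite /w /y -evs_cat -takeD /k subnKC // ltnW.
  have XE j : X n' j = y^-1 * X n j * y.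
    by rewrite /X wE invgM !mulgA.
  have yk : hd (vn n) y = ln n.
    have c1 : conj_chain (X n i) (take k (drop n s)).
      by have := chainX n; rewrite -{1}(cat_take_drop k (drop n s)) => /conj_chain_cat [].
    have Ek : take k (drop n s) = (vn n, ln n) :: take (n' - n.+1) (drop n.+1 s).
      by rewrite dropE // /k subnS -[(n' - n)%N]prednK // subn_gt0.
    by rewrite /y Ek; apply: (conj_chain_first (tX n i)); rewrite -Ek.
  have yV : hd (vn n) y^-1 = 0.
    rewrite Ev; apply: (conj_chain_hd0 (t := X n i) (l := ln n') (s2 := drop n'.+1 s)) => //.
    rewrite -dropE //; have -> : drop n' s = drop k (drop n s).
      by rewrite drop_drop /k subnK // ltnW.
    by rewrite cat_take_drop.
  have ln0 : ln n != 0 by have [] := Xi n ns.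
  have yout : ~~ (supp y \subset star (vn n)).
    apply/negP => ys; have := hd_inv_star ys; rewrite yk yV addn0 modn_small.
      by move=> E; rewrite E in ln0.
    by rewrite -yk hd_lt.
  have nearN : Near n \subset Near n'.
    apply/subsetP => j; rewrite !inE /Out -Ev => /andP [jo jn].
    have [||o1 o2] := @torsion_nested (vn n) (vn n) y (X n j) (tX n j) jo.
    - by move/crossing_same; apply/negP.
    - by rewrite yk; apply/eqP.
    rewrite XE o1 o2 yV eq_sym /=; by have [_ _] := Xi n' ns'.
  have farN : Far n' \subset Far n.
    apply/subsetP => j; rewrite !inE /Out -Ev => /andP [jo /eqP jn].
    have [||o1 o2] := @torsion_nested (vn n) (vn n) y^-1 (X n' j) (tX n' j) jo.
    - by move/crossing_same; rewrite suppV; apply/negP.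
    - by rewrite yV jn; apply/eqP; have [_ _] := Xi n' ns'.
    have E : X n j = y^-1^-1 * X n' j * y^-1.
      by rewrite XE invgK !mulgA mulgV mul1g mulgK.
    by rewrite E o1 o2 invgK yk eqxx.
  (* Equality means that the same images stabilize both walls. [minimal_near] supplies an image on
     the side of 1, and [rigid] applies to the conjugate of [f] for which the first wall becomes (1,
     vn n). *)
  split=> // -[NE FE].
  have [iout ihd _] := Xi n ns.
  have [j jout jhd] : exists2 j, ~~ (supp (X n j) \subset star (vn n)) &
      hd (vn n) (X n j) = hd (vn n) (w n)^-1.
    apply: (minimal_near tt fmin (i := i)) => //.
    by rewrite -/(X n i) ihd w0 //; apply/eqP.
  pose f' : aut W := inner (w n)^-1 * f.
  have f'E k' : f' (gen k') = X n k' by rewrite autmulE innerE invgK.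
  apply: (@rigid f' (vn n) y (ln n) i j noSIL yout); rewrite ?f'E //.
    move=> c'; rewrite f'E -XE => cin; apply/negPn/negP => cout.
    have [E|E] := eqVneq (hd (vn n') (X n' c')) (ln n').
      have : c' \in Far n' by rewrite inE /Out -Ev cout Ev E eqxx.
      by rewrite -FE inE /Out cin.
    have : c' \in Near n' by rewrite inE /Out -Ev cout Ev E.
    by rewrite -NE inE /Out cin.
  by rewrite jhd w0 //; apply/eqP; rewrite eq_sym.
(* Along the walls of one type this potential strictly increases among its [2 * N + 1] possible
   values. *)
pose pos (n : 'I_(size s)) : 'I_N * 'I_(2 * N).+1 :=
  (vn n, inord (#|Near n| + (N - #|Far n|))).
have cardN (D : {set 'I_N}) : (#|D| <= N)%N by rewrite -[leqRHS]card_ord max_card.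
have incr n n' : (n < n' < size s)%N -> vn n = vn n' ->
    (#|Near n| + (N - #|Far n|) < #|Near n'| + (N - #|Far n'|))%N.
  move=> nn' Ev; have [NN FF ne] := nested n n' nn' Ev.
  have leN := subset_leq_card NN; have leF := subset_leq_card FF.
  have squeeze (a a' b b' M : nat) : a <= a' -> b' <= b -> b <= M ->
      a' + (M - b') <= a + (M - b) -> a' <= a /\ b <= b' by lia.
  rewrite ltnNge; apply/negP => /(squeeze _ _ _ _ _ leN leF (cardN _)) [lN lF].
  apply: ne; split; first by apply/eqP; rewrite eqEcard NN.
  by apply/esym/eqP; rewrite eqEcard FF.
have pos_inj : injective pos.
  move=> n n' [Ev] /(congr1 (@nat_of_ord _)); rewrite !inordK; first last.
  - by rewrite ltnS mul2n -addnn leq_add ?leq_subr.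
  - by rewrite ltnS mul2n -addnn leq_add ?leq_subr.
  move=> En; apply: ord_inj; have [lt|lt|//] := ltngtP (n : nat) n'.
    have nn' : (n < n' < size s)%N by rewrite lt ltn_ord.
    by have := incr _ _ nn' Ev; rewrite En ltnn.
  have nn' : (n' < n < size s)%N by rewrite lt ltn_ord.
  by have := incr _ _ nn' (esym Ev); rewrite En ltnn.
by have := leq_card pos pos_inj; rewrite card_prod !card_ord.
Qed.

End FiniteOut.

(** * Hyperbolicity of the automorphism group *)

Section AutHyperbolic.
Implicit Types (u v : 'I_N) (x y z g w : W) (f : aut W).

Definition syllables : seq W := [seq syl v k | v <- enum 'I_N, k <- iota 0 (m v)].

Lemma mem_syllables v k : (k < m v)%N -> syl v k \in syllables.
Proof.
by move=> km; apply: allpairs_f_dep; rewrite ?mem_enum // mem_iota.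
Qed.

Fixpoint len_ball (r : nat) : seq W :=
  if r is r'.+1 then 1 :: [seq s * x | s <- syllables, x <- len_ball r']
  else [:: 1].

Lemma len_ballP r x : (len x <= r)%N -> x \in len_ball r.
Proof.
elim/syl_ind: x r => [|v k x km x0 IH] [|r] //=; rewrite ?mem_head //.
- by rewrite len_push.
- rewrite len_push // ltnS => /IH xr; rewrite in_cons; apply/orP; right.
  by apply: allpairs_f => //; apply: mem_syllables; case/andP: km.
Qed.

Lemma aut_gen_eq f f' : (forall i, f (gen i) = f' (gen i)) -> f = f'.
Proof.
move=> E; apply: aut_eqP => x.
elim/syl_ind: x => [|v k x km x0 IH]; first by rewrite !aut1.
by rewrite !autM IH /syl !autX E.
Qed.

(** A central element has its support in every star, so the support is a clique. *)
Lemma inner_id_len z : inner z = 1 -> (len z <= N)%N.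
Proof.
move=> z1; apply: len_clique_order => u v uz vz.
have zv : commute z (gen v).
  have : inner z (gen v) = gen v by rewrite z1.
  by rewrite innerE /commute => {2}<-; rewrite mulgVK.
exact: (subsetP (centralizer_gen zv)).
Qed.

(** An automorphism is determined by the images of the generators; after a conjugation that
    minimizes their total length, these lie in a finite ball. *)
Lemma finite_out : ~ has_SIL adj -> exists reps : seq (aut W),
  forall f, exists g r, r \in reps /\ f = inner g * r.
Proof.
move=> noSIL; pose B := len_ball diameter_bound.
pose D f (e : {ffun 'I_N -> 'I_(size B)}) := forall i, f (gen i) = nth 1 B (e i).
have exF e : exists f, (exists f', D f' e) -> D f e.
  by have [[f fe]|no] := pselect (exists f, D f e); [exists f | exists 1].
have [F FP] := choice exF.
exists [seq F e | e <- enum {ffun 'I_N -> 'I_(size B)}] => f.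
pose T g := (\sum_i len (g^-1 * f (gen i) * g))%N.
have exT : exists n, `[< exists g, T g = n >] by exists (T 1); apply/asboolP; exists 1.
have [n /asboolP [g gn] nmin] := ex_minnP exT.
pose f' : aut W := inner g^-1 * f.
have f'E x : f' x = g^-1 * f x * g by rewrite autmulE innerE invgK.
have f'min w : (\sum_i len (f' (gen i)) <= \sum_i len (w^-1 * f' (gen i) * w))%N.
  have -> : (\sum_i len (f' (gen i)))%N = n.
    by rewrite -gn; apply: eq_bigr => i _; rewrite f'E.
  have -> : (\sum_i len (w^-1 * f' (gen i) * w))%N = T (g * w).
    by apply: eq_bigr => i _; rewrite f'E invgM !mulgA.
  by apply: nmin; apply/asboolP; exists (g * w).
have small := minimal_bounded noSIL f'min.
have inB i : f' (gen i) \in B by apply: len_ballP.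
have iB i : (index (f' (gen i)) B < size B)%N by rewrite index_mem.
pose e := [ffun i => Ordinal (iB i)].
have De : D f' e by move=> i; rewrite ffunE nth_index.
exists g, (F e); split; first by rewrite map_f ?mem_enum.
have -> : F e = f'.
  by apply: aut_gen_eq => i; rewrite De; apply: FP; exists f'.
by rewrite /f' mulgA -innerM mulgV inner1 mul1g.
Qed.

Hypothesis no_SIL : ~ has_SIL adj.
Hypothesis no_square : forall A B : {set 'I_N},
  (forall u v, u \in A -> v \in B -> adj u v) -> clique A \/ clique B.

Lemma aut_hyperbolic : word_hyperbolic (aut W).
Proof.
have [reps repsP] := finite_out no_SIL.
have [gw gwP] := choice repsP; have [rw rwP] := choice gwP.
pose S : seq (aut W) := reps ++ map (@inner _) syllables.
have sp_inner x : spelled S (inner x) (len x).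
  elim/syl_ind: x => [|v k x km x0 IH].
    by rewrite inner1 len1; apply: spelled1.
  rewrite len_push // innerM -add1n; apply: spelledM IH; apply: spelled_gen.
  by rewrite mem_cat map_f ?orbT // mem_syllables //; case/andP: km.
have genS : generates S.
  move=> f; have [rr fE] := rwP f; exists (len (gw f) + 1)%N.
  rewrite {1}fE; apply: spelledM => //; apply: spelled_gen.
  by rewrite mem_cat rr.
pose d := word_dist genS.
have d_inner x y : (d (inner x) (inner y) <= len (x^-1 * y))%N.
  rewrite /d /word_dist -innerV -innerM.
  exact/word_length_min/sp_inner.
have d_rep f : (d f (inner (gw f)) <= 1)%N.
  have [rr fE] := rwP f; rewrite /d word_dist_sym /word_dist {2}fE mulKg.
  by apply: word_length_gen; rewrite mem_cat rr.
have d_tri f1 f2 f3 : (d f1 f3 <= d f1 f2 + d f2 f3)%N by apply: word_dist_tri.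
(* For neighbours [f], [f'] the inner automorphism of [a^-1 * b] lies in the finite set [E]; the
   preimage [c e] chosen in W is correct up to the centre, which costs [N]. *)
have [M HM] : exists M, forall f f', (d f f' <= 1)%N -> (len ((gw f)^-1 * gw f') <= M)%N.
  pose S1 := 1 :: S ++ [seq s^-1 | s <- S].
  pose E := [seq r * s | r <- reps, s <- [seq s * r'^-1 | s <- S1, r' <- reps]].
  have exc e : exists g, (exists g', inner g' = e) -> inner g = e.
    by have [[g ge]|no] := pselect (exists g, inner g = e); [exists g | exists 1].
  have [c cP] := choice exc.
  exists (\max_(e <- E) len (c e) + N)%N => f f' ff'.
  have [rf fE] := rwP f; have [rf' f'E] := rwP f'.
  set a := gw f in fE *; set b := gw f' in f'E *.
  pose e := rw f * (f^-1 * f') * (rw f')^-1.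
  have eE : inner (a^-1 * b) = e.
    have E1 : rw f = (inner a)^-1 * f by rewrite [in RHS]fE mulKg.
    have E2 : rw f' = (inner b)^-1 * f' by rewrite [in RHS]f'E mulKg.
    by rewrite /e E1 E2 innerM innerV invgM invgK !mulgA !mulgK.
  have eInE : e \in E.
    rewrite /e -mulgA; apply: allpairs_f => //; apply: allpairs_f => //.
    have [->|[s sS [->|->]]] := word_length_le1 ff'; rewrite in_cons ?eqxx //.
      by rewrite mem_cat sS orbT.
    by rewrite mem_cat map_f ?orbT.
  have ce : inner (c e) = inner (a^-1 * b).
    by rewrite eE; apply: cP; exists (a^-1 * b).
  have -> : a^-1 * b = c e * ((c e)^-1 * (a^-1 * b)) by rewrite mulVKg.
  apply: leq_trans (lenM _ _) _; apply: leq_add.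
    by apply: leq_bigmax_seq.
  by apply: inner_id_len; rewrite innerM innerV ce mulVg.
have [C HC] := hull_bounded no_square M.
(* The guessed path jumps from [f] to its inner part, follows the quasi-interval of W, and jumps to
   [f']. *)
pose L f f' (p : aut W) := [\/ p = f, p = f' |
  exists2 x, hull (gw f) (gw f') x & p = inner x].
pose h := (N + C + 2)%N.
have Lhull f f' x : hull (gw f) (gw f') x -> L f f' (inner x).
  by move=> Hx; apply: Or33; exists x.
have L_conn f f' (P : aut W -> Prop) : P f ->
    (forall p q, L f f' p -> L f f' q -> (d p q <= h)%N -> P p -> P q) -> P f'.
  move=> Pf step.
  have Pl : P (inner (gw f)).
    apply: step Pf; [exact: Or31 | exact/Lhull/hull_l |].
    by apply: leq_trans (d_rep f) _; rewrite /h; lia.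
  have Pr : P (inner (gw f')).
    apply: (hull_connected (a := gw f) (c := gw f') (P := fun x => P (inner x))) => // p q hp hq pq.
    apply: step; [exact: Lhull | exact: Lhull |].
    by apply: leq_trans (d_inner _ _) (leq_trans pq _); rewrite /h; lia.
  apply: step Pr; [exact/Lhull/hull_r | exact: Or32 |].
  by rewrite /d word_dist_sym; apply: leq_trans (d_rep f') _; rewrite /h; lia.
have d0 f : d f f = 0 by rewrite /d /word_dist mulVg word_length1.
have L_thin f f' f2 p : L f f' p ->
    exists2 q, L f f2 q \/ L f2 f' q & (d p q <= h)%N.
  case=> [->|->|[x Hx ->]].
  - by exists f; [left; apply: Or31 | rewrite d0].
  - by exists f'; [right; apply: Or32 | rewrite d0].
  have [y Hy xy] := hull_thin no_square (gw f2) Hx.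
  exists (inner y); first by case: Hy => /Lhull; [left|right].
  by apply: leq_trans (d_inner _ _) (leq_trans xy _); rewrite /h; lia.
have L_small f f' p : (d f f' <= 1)%N -> L f f' p -> (d f p <= h)%N.
  move=> ff'; case=> [->|->|[x Hx ->]]; first by rewrite d0.
    by apply: leq_trans ff' _; rewrite /h; lia.
  apply: leq_trans (d_tri _ (inner (gw f)) _) _.
  have := HC _ _ _ (HM _ _ ff') Hx; have := d_inner (gw f) x; have := d_rep f.
  rewrite /h; set a := d _ _; set b := d _ _; set c := len _; lia.
have [D HD] := @guess_four_point (aut W) d L h (word_dist_sym genS) d_tri
  (word_dist_geod genS) (fun f f' => Or31 _ _ erefl) (fun f f' => Or32 _ _ erefl)
  L_conn L_thin L_small.
by apply/word_hyperbolicP; exists S, genS, D.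
Qed.

End AutHyperbolic.

(** * Flat planes in the automorphism group *)

Section Flats.
Implicit Types (i j k v : 'I_N) (x y z g w : W) (f : aut W).

Lemma hd_gen v i : hd v (gen i : W) = (i == v).
Proof.
have E : hd i (gen i) = 1%N.
  by rewrite -syl1 -(mulg1 (syl i 1)) hd_syl hd1 addn0 modn_small.
case: eqP => [<- //|iv]; apply: hd_notin; apply/negP => vi.
have := subsetP (supp_syl1 i 1) v; rewrite syl1 => /(_ vi).
by rewrite inE => /eqP E2; apply: iv.
Qed.

Lemma hd_alternating i j z d : i \notin star j -> hd j z = 0 -> 0 < d ->
  hd i ((gen i * gen j) ^+ d * z) = 1%N.
Proof.
move=> ij; have ji : j \notin star i by rewrite star_sym.
have step y : hd j y = 0 -> hd i (gen i * gen j * y) = 1%N.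
  move=> y0; have h1 : hd j (gen j * y) != 0.
    by rewrite -syl1 hd_syl y0 addn0 modn_small.
  by rewrite -mulgA -(syl1 i) hd_syl (hd_excl ij h1) addn0 modn_small.
case: d => // d z0 _; elim: d => [|d IH]; first by rewrite expg1 step.
by rewrite expgS -mulgA step // (hd_excl ji) // IH.
Qed.

(** The power starts with [gen i] whatever follows it, provided that [j] is not a head there; a
    preceding [gen k] would change the head at [i]. *)
Lemma alternating_not_commute i j k d : i \notin star j -> k != j ->
  (k = i) \/ (k \notin star i) -> 0 < d ->
  ~ commute ((gen i * gen j) ^+ d) (gen k : W).
Proof.
move=> ij kj ki d0 E; have := congr1 (hd i) E.
rewrite (hd_alternating ij _ d0); last by rewrite hd_gen (negPf kj).
have a1 : hd i ((gen i * gen j : W) ^+ d) = 1%N.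
  by rewrite -(mulg1 (_ ^+ d)) hd_alternating // hd1.
case: ki => [->|ki]; first by rewrite -syl1 hd_syl a1 => /esym /succ_modn_neq; apply.
have ik : i \notin star k by rewrite star_sym.
rewrite (hd_excl ik) // -syl1 hd_syl.
by rewrite (hd_excl ki) ?a1 // addn0 modn_small.
Qed.

Lemma conj_powers_inj (a x : W) n n' :
  (forall d, 0 < d -> ~ commute (a ^+ d) x) ->
  a ^+ n * x * (a ^+ n)^-1 = a ^+ n' * x * (a ^+ n')^-1 -> n = n'.
Proof.
move=> nc; wlog: n n' / (n <= n')%N => [gen_case|].
  by case: (leqP n n') => [|/ltnW] le E; [|apply/esym]; apply: gen_case le _.
rewrite leq_eqVlt => /orP [/eqP //|lt] E; exfalso.
apply: (nc (n' - n)%N); first by rewrite subn_gt0.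
have En : a ^+ n' = a ^+ n * a ^+ (n' - n) by rewrite -expgnDr subnKC // ltnW.
rewrite /commute; move: E; rewrite En; set b := a ^+ (n' - n); set c := a ^+ n.
rewrite invgM -!mulgA => /mulgI; rewrite !mulgA => /mulIg E.
by rewrite {2}E mulgVK.
Qed.

Lemma square_not_hyperbolic (v0 v1 v2 v3 : 'I_N) :
  adj v0 v1 -> adj v1 v2 -> adj v2 v3 -> adj v3 v0 ->
  v0 \notin star v2 -> v1 \notin star v3 -> ~ word_hyperbolic (aut W).
Proof.
move=> a01 a12 a23 a30 n02 n13.
pose a : W := gen v0 * gen v2; pose b : W := gen v1 * gen v3.
have c01 : commute (gen v0 : W) (gen v1) by apply: gen_comm.
have c21 : commute (gen v2 : W) (gen v1) by apply/commute_sym/gen_comm.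
have c03 : commute (gen v0 : W) (gen v3) by apply/commute_sym/gen_comm.
have c23 : commute (gen v2 : W) (gen v3) by apply: gen_comm.
have cb0 : commute (gen v0 : W) b by apply: commuteM.
have cb2 : commute (gen v2 : W) b by apply: commuteM.
have ca1 : commute (gen v1 : W) a by apply: commuteM; apply: commute_sym.
have cab : commute a b by apply/commute_sym/commuteM; apply: commute_sym.
apply: (@flat_plane_not_hyperbolic _ (inner a) (inner b)).
  by rewrite /commute -!innerM cab.
move=> n1 n2 n1' n2'; rewrite !innerX -!innerM => E.
(* [b] commutes with [gen v0], so evaluation there isolates the power of [a]; evaluation at [gen v1]
   isolates that of [b]. *)
have E0 : inner (a ^+ n1) (gen v0) = inner (a ^+ n1') (gen v0).
  have fix0 n : inner (b ^+ n) (gen v0) = gen v0.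
    by rewrite innerE -(commuteX n cb0) mulgK.
  have := congr1 (fun f : aut W => f (gen v0)) E.
  by rewrite !innerM !autmulE !fix0.
have E1 : inner (b ^+ n2) (gen v1) = inner (b ^+ n2') (gen v1).
  have fix1 n : inner (a ^+ n) (gen v1) = gen v1.
    by rewrite innerE -(commuteX n ca1) mulgK.
  have := congr1 (fun f : aut W => f (gen v1)) E.
  have swap n n' : inner (a ^+ n * b ^+ n') = inner (b ^+ n') * inner (a ^+ n).
    by rewrite -innerM; congr inner; apply: commuteX2.
  by rewrite !swap !autmulE !fix1.
split.
  apply: (conj_powers_inj (a := a) (x := gen v0)) E0 => d d0.
  by apply: alternating_not_commute => //; [case: (notin_star n02) | left].
apply: (conj_powers_inj (a := b) (x := gen v1)) E1 => d d0.
by apply: alternating_not_commute => //; [case: (notin_star n13) | left].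
Qed.

(** * Partial conjugations *)

Section PartialConjugation.
Variable R : {set 'I_N}.

(** The second condition preserves the relations of the edges that leave [R]; the first one makes
    the partial conjugation fix [a], so that the one by [a^-1] inverts it. *)
Definition separated (a : W) : Prop := [disjoint supp a & R] /\
  forall k l, k \in R -> l \notin R -> adj k l -> commute a (gen l).

Definition pconj_gen (a : W) k : W :=
  if k \in R then a * gen k * a^-1 else gen k.

Lemma pconj_gen_rels a : separated a -> forall s t : word 'I_N,
  graph_product_rels adj m s t ->
  word_image (pconj_gen a) s = word_image (pconj_gen a) t.
Proof.
case=> _ sep s t [k|k l kl].
  have E n : word_image (pconj_gen a) (nseq n (k, false)) = pconj_gen a k ^+ n.
    elim: n => [|n IH]; first by rewrite /word_image /eval_word big_nil.
    by rewrite /= expgS -IH /word_image /eval_word big_cons.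
  rewrite E /word_image /eval_word big_nil /pconj_gen.
  have gk : gen k ^+ m k = 1 :> W by apply: syl_order.
  case: ifP => // _; have -> : a * gen k * a^-1 = gen k ^ a^-1.
    by rewrite conjgE invgK mulgA.
  by rewrite -conjXg gk conj1g.
rewrite /word_image /eval_word /= !big_cons !big_nil !mulg1 /pconj_gen.
have gkl : gen k * gen l = gen l * gen k :> W by apply: gen_comm.
have E (k' l' : 'I_N) : k' \in R -> l' \notin R -> adj k' l' ->
    gen k' * gen l' = gen l' * gen k' ->
    a * gen k' * a^-1 * gen l' = gen l' * (a * gen k' * a^-1).
  move=> kR lR kl' gk; have al := sep k' l' kR lR kl'.
  have alV : a^-1 * gen l' = gen l' * a^-1 by apply/esym/commuteV/commute_sym.
  by rewrite -!mulgA alV !mulgA -(mulgA a) gk !mulgA al.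
have lk : adj l k by rewrite edge_sym.
case: (boolP (k \in R)) => kR; case: (boolP (l \in R)) => lR //.
- by rewrite !mulgA !mulgVK -(mulgA a) gkl !mulgA.
- exact: E.
- exact/esym/E.
Qed.

Definition pconj_fun a : W -> W := lift_pres (rels := graph_product_rels adj m) (pconj_gen a).

Lemma pconj_funM a : separated a -> {morph pconj_fun a : x y / x * y}.
Proof. by move=> sep; apply: lift_presM; apply: pconj_gen_rels. Qed.

Lemma pconj_fun_gen a k : separated a -> pconj_fun a (gen k) = pconj_gen a k.
Proof.
move=> sep; rewrite /pconj_fun lift_presE; last exact: pconj_gen_rels.
by rewrite /word_image /eval_word big_seq1.
Qed.

Lemma pconj_fun_fix a x : separated a -> [disjoint supp x & R] -> pconj_fun a x = x.
Proof.
move=> sep; elim/syl_ind: x => [|v k x km x0 IH] dx.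
  by rewrite morph_one //; apply: pconj_funM.
move: dx; rewrite supp_push // disjoints_subset subUset sub1set -disjoints_subset.
case/andP=> vR /IH E; rewrite pconj_funM // E /syl morph_exp; last exact: pconj_funM.
by rewrite pconj_fun_gen // /pconj_gen; rewrite in_setC in vR; rewrite (negPf vR).
Qed.

Lemma separatedV a : separated a -> separated a^-1.
Proof.
case=> dis sep; split; first by rewrite suppV.
by move=> k l kR lR kl; apply/commute_sym/commuteV/commute_sym/(sep k).
Qed.

Lemma pconj_funK a : separated a -> cancel (pconj_fun a) (pconj_fun a^-1).
Proof.
move=> sep x; have sepV := separatedV sep.
have M1 := pconj_funM sep; have M2 := pconj_funM sepV.
elim/syl_ind: x => [|v k x km x0 IH]; first by rewrite !morph_one.
rewrite M1 M2 IH /syl !morph_exp // pconj_fun_gen // {1}/pconj_gen.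
case: ifP => [vR|vR]; last by rewrite pconj_fun_gen // /pconj_gen vR.
have fa : pconj_fun a^-1 a = a by apply: pconj_fun_fix => //; case: sep.
have faV : pconj_fun a^-1 a^-1 = a^-1 by apply: pconj_fun_fix => //; case: sepV.
rewrite !M2 fa faV pconj_fun_gen // /pconj_gen vR invgK.
by rewrite !mulgA mulgV mul1g mulgK.
Qed.

Definition pconj a (sep : separated a) : aut W.
Proof.
refine (@Aut _ (pconj_fun a) (pconj_fun a^-1) (pconj_funM sep) (pconj_funK sep) _).
by have := pconj_funK (separatedV sep); rewrite invgK.
Defined.

Lemma pconjX_gen a (sep : separated a) n k : (pconj sep ^+ n) (gen k) =
  if k \in R then a ^+ n * gen k * (a ^+ n)^-1 else gen k.
Proof.
elim: n => [|n IH]; first by rewrite expg0 mul1g invg1 mulg1; case: ifP.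
rewrite expgS autmulE IH; case: ifP => kR; last first.
  by rewrite /= pconj_fun_gen // /pconj_gen kR.
have fX : pconj sep (a ^+ n) = a ^+ n.
  by rewrite autX; congr (_ ^+ n); exact: pconj_fun_fix sep.1.
rewrite !autM autV fX.
have -> : pconj sep (gen k) = a * gen k * a^-1.
  by rewrite /= pconj_fun_gen // /pconj_gen kR.
by rewrite expgSr invgM !mulgA.
Qed.

End PartialConjugation.

(** [f] fixes [gen i], so evaluation there reads off the exponent of [inner a]; once this is
    cancelled, evaluation at [gen x0] reads off that of [f]. *)
Lemma SIL_not_hyperbolic : has_SIL adj -> ~ word_hyperbolic (aut W).
Proof.
case=> i [j [ij dij [R [[x0 x0D RE] iR jR]]]].
have ijs : i \notin star j.
  rewrite in_star negb_or; apply/andP; split; first by apply/eqP => E; rewrite E ltnn in ij.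
  by apply/negP => aij; have := dij [:: j]; rewrite /= aij => /(_ isT erefl).
set D := ~: _ in x0D RE.
have inD k : k \in R -> k \in D.
  rewrite RE inE => /connectP [s]; elim: s x0 x0D {RE} => [x xD _ -> //|c s IH x xD /=].
  by case/andP=> /and3P [_ cD _]; apply: IH.
have stepR k l : k \in R -> l \in D -> adj k l -> l \in R.
  move=> kR lD kl; have kD := inD _ kR; move: kR; rewrite RE !inE => kR.
  by apply: connect_trans kR _; apply: connect1; apply/and3P.
pose a : W := gen i * gen j.
have x0R : x0 \in R by rewrite RE inE connect0.
(* [i] is not in its own link, so it survives the removal of the common link; an edge from [x0]
   would put it into [R]. *)
have x0i : x0 \notin star i.
  rewrite in_star negb_or; apply/andP; split.
    by apply: contraNneq iR => <-.
  apply: contra iR => ai; apply: stepR x0R _ ai.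
  by rewrite /D !inE edge_irr.
have sep : separated R a.
  split.
    rewrite disjoints_subset; apply: suppM_sub; rewrite -syl1;
      by apply: subset_trans (supp_syl1 _ _) _; rewrite sub1set in_setC.
  move=> k l kR lR kl; have : l \notin D by apply: contra lR => lD; apply: stepR kl.
  rewrite /D in_setC negbK in_setI !inE => /andP [il jl].
  by apply/commute_sym/commuteM; apply/commute_sym/gen_comm.
pose f := pconj sep.
have fa : f a = a by exact: pconj_fun_fix sep.1.
have fgi n : (f ^+ n) (gen i) = gen i by rewrite pconjX_gen (negPf iR).
apply: (@flat_plane_not_hyperbolic _ (inner a) f).
  by apply: aut_eqP => x; rewrite !autmulE !innerE (autM f (a * x)) (autM f a) autV fa.
move=> n1 n2 n1' n2' E.
have E1 : n1 = n1'.
  have := congr1 (fun f : aut W => f (gen i)) E.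
  rewrite !autmulE !fgi !innerX !innerE; apply: conj_powers_inj => d d0.
  apply: alternating_not_commute => //; last by left.
  by case: (notin_star ijs).
split=> //; subst n1'; move/mulgI: E => E.
have := congr1 (fun f : aut W => f (gen x0)) E.
rewrite !pconjX_gen x0R; apply: conj_powers_inj => d d0.
apply: alternating_not_commute => //; last by right.
by apply: contraNneq jR => <-.
Qed.

(** Non-adjacent pairs in [A] and in [B] alternate on a circuit of length four without chord. *)
Lemma no_square_joined : four_circuits_have_chords adj ->
  forall A B : {set 'I_N},
  (forall u v, u \in A -> v \in B -> adj u v) -> clique A \/ clique B.
Proof.
move=> sq A B AB; apply: contrapT => no.
have [a1 [a2 [a1A a2A a12]]] : exists a1 a2 : 'I_N, [/\ a1 \in A, a2 \in A & a1 \notin star a2].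
  apply: contrapT => nA; apply: no; left => u v uA vA.
  by apply/negPn/negP => uv; apply: nA; exists u, v.
have [b1 [b2 [b1B b2B b12]]] : exists b1 b2 : 'I_N, [/\ b1 \in B, b2 \in B & b1 \notin star b2].
  apply: contrapT => nB; apply: no; right => u v uB vB.
  by apply/negPn/negP => uv; apply: nB; exists u, v.
have [a12n a12a] := notin_star a12; have [b12n b12a] := notin_star b12.
have a1b1 := AB _ _ a1A b1B; have a1b2 := AB _ _ a1A b2B.
have a2b1 := AB _ _ a2A b1B; have a2b2 := AB _ _ a2A b2B.
have n11 := negPf (edge_neq a1b1); have n12 := negPf (edge_neq a1b2).
have n21 := negPf (edge_neq a2b1); have n22 := negPf (edge_neq a2b2).
have a12f := negPf a12n; have b12f := negPf b12n.
have [|x [y [xc yc xy]]] := sq [:: a1; b1; a2; b2] erefl.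
  rewrite /ucycle /ucycleb /= a1b1 edge_sym a2b1 a2b2 edge_sym a1b2 /=.
  by rewrite !inE n11 a12f n12 eq_sym n21 b12f n22.
move: xc yc xy; rewrite !inE.
have E1 : next [:: a1; b1; a2; b2] a1 = b1 by rewrite /= eqxx.
have E2 : next [:: a1; b1; a2; b2] b1 = a2 by rewrite /= [b1 == a1]eq_sym n11 eqxx.
have E3 : next [:: a1; b1; a2; b2] a2 = b2.
  by rewrite /= [a2 == a1]eq_sym a12f n21 eqxx.
have E4 : next [:: a1; b1; a2; b2] b2 = a1.
  by rewrite /= ![b2 == _]eq_sym n12 b12f n22 eqxx.
by case/or4P=> /eqP -> /or4P [] /eqP -> e; rewrite ?E1 ?E2 ?E3 ?E4 ?eqxx //;
  move: e; rewrite ?edge_irr ?(negPf a12a) ?(negPf b12a) // edge_sym ?(negPf a12a) ?(negPf b12a).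
Qed.

Lemma chordless_not_hyperbolic : ~ four_circuits_have_chords adj ->
  ~ word_hyperbolic (aut W).
Proof.
move=> nsq hyp; apply: nsq => -[|a [|b [|c [|d [|//]]]]] // _ ucy.
apply: contrapT => nch.
move: (ucy); rewrite /ucycle /ucycleb /= !inE !negb_or andbT.
case/andP=> /and4P [ab bc cd da] /and4P [/and3P [nab nac nad] /andP [nbc nbd] ncd _].
have E1 : next [:: a; b; c; d] a = b by rewrite /= eqxx.
have E2 : next [:: a; b; c; d] b = c by rewrite /= [b == a]eq_sym (negPf nab) eqxx.
have E3 : next [:: a; b; c; d] c = d by rewrite /= ![c == _]eq_sym (negPf nac) (negPf nbc) eqxx.
have E4 : next [:: a; b; c; d] d = a.
  by rewrite /= ![d == _]eq_sym (negPf nad) (negPf nbd) (negPf ncd) eqxx.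
apply: (square_not_hyperbolic ab bc cd da) hyp.
  rewrite in_star negb_or nac /=; apply/negP => ac; apply: nch.
  exists a, c; rewrite !inE !eqxx ?orbT E1 E3; split=> //.
  by rewrite eq_sym.
rewrite in_star negb_or nbd /=; apply/negP => bd; apply: nch.
exists b, d; rewrite !inE !eqxx ?orbT E2 E4; by split.
Qed.

End Flats.

End GraphProducts.

Theorem corollary8p7 (N : nat) (adj : rel 'I_N) (m : 'I_N -> nat)
    (N_gt0 : (0 < N)%N)
    (adj_sym : symmetric adj) (adj_irr : irreflexive adj)
    (m_pp : forall i : 'I_N, prime_power (m i)) :
  word_hyperbolic (aut (graph_product adj m)) <->
  ~ has_SIL adj /\ four_circuits_have_chords adj.
Proof.
have m_gt1 i : (1 < m i)%N.
  have [p [a [pp a0 ->]]] := m_pp i.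
  by rewrite -(expn0 p) ltn_exp2l // prime_gt1.
pose G := LabelledGraph adj_sym adj_irr m_gt1.
split=> [hyp|[nSIL sq]]; last first.
  exact: (@aut_hyperbolic G nSIL (@no_square_joined G sq)).
split; first by move=> sil; apply: (@SIL_not_hyperbolic G).
by apply: contrapT => nsq; apply: (@chordless_not_hyperbolic G).
Qed.
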